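(* Let $A$ be an unbounded self-adjoint operator on a complex Hilbert space $\mathcal{H}$. Then there is a projection-valued measure $P:\operatorname{Borel}(\mathbb{R})\to\mathcal{B}(\mathcal{H})$ such that $$A=\int_{\mathbb{R}}\operatorname{id}\,dP$$ (equality of unbounded operators on $\mathcal{H}$, including equality of domains), where $\operatorname{id}$ is the identity function on $\mathbb{R}$.
   Context: All Hilbert spaces are complex and inner products are conjugate-linear in the first coordinate. $\mathcal{B}(\mathcal{H})$ is the algebra of bounded operators on $\mathcal{H}$ and $\operatorname{Borel}(\mathbb{R})$ is the $\sigma$-algebra of Borel subsets of $\mathbb{R}$. An unbounded operator on $\mathcal{H}$ is a linear map $A:D(A)\to\mathcal{H}$ with $D(A)$ a dense subspace of $\mathcal{H}$ (it may happen to be bounded). Its adjoint $A^*$ has domain $D(A^* )$ consisting of all $x\in\mathcal{H}$ for which $y\mapsto\langle x,Ay\rangle$ is bounded on $D(A)$, and $A^*x$ is the unique element with $\langle A^*x,y\rangle=\langle x,Ay\rangle$ for all $y\in D(A)$. $A$ is self-adjoint if $A=A^*$ (including $D(A)=D(A^* )$). A projection-valued measure on a measurable space $(X,\mathfrak{B})$ is a function $P:\mathfrak{B}\to\mathcal{B}(\mathcal{H})$, written $P_\Omega:=P(\Omega)$, such that each $P_\Omega$ is an (orthogonal) projection, $P_\emptyset=0$, $P_X=I$, and for pairwise disjoint $(\Omega_n)_{n\in\mathbb{N}}$ in $\mathfrak{B}$ with union $\Omega$ one has $P_\Omega x=\sum_n P_{\Omega_n}x$ for all $x\in\mathcal{H}$.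 For $x,y\in\mathcal{H}$ let $\mu^{x,y}(\Omega):=\langle y,P_\Omega x\rangle$, a complex measure, and $\mu^x:=\mu^{x,x}$, a finite positive measure. For measurable $f:X\to\mathbb{C}$, $\int_X f\,dP$ is the unbounded operator with domain $\{x\in\mathcal{H}:\int_X|f|^2\,d\mu^x<\infty\}$ determined by $\langle y,(\int_X f\,dP)x\rangle=\int_X f\,d\mu^{x,y}$ for all $y\in\mathcal{H}$. *)

(* Defs.v *)
From HB Require Import structures.
From mathcomp Require Import all_boot all_order all_algebra.
From mathcomp Require Import all_classical all_reals all_analysis.
From mathcomp Require Import complex.

Set Implicit Arguments.
Unset Strict Implicit.
Unset Printing Implicit Defensive.

Import Order.TTheory GRing.Theory Num.Theory.
Import numFieldNormedType.Exports.

Local Open Scope classical_set_scope.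
Local Open Scope ring_scope.
Local Open Scope complex_scope.

(* Complex Hilbert spaces: complete normed modules over R[i] whose norm comes
   from an inner product, conjugate-linear in the first coordinate.
   Positive definiteness is that of the norm. *)
HB.mixin Record CompleteNormedModule_isHilbert (R : realType) H
    of CompleteNormedModule R[i] H := {
  inner : H -> H -> R[i] ;
  innerC : forall x y : H, inner x y = conjc (inner y x) ;
  innerPr : forall (a : R[i]) (x y z : H),
    inner x (a *: y + z) = a * inner x y + inner x z ;
  inner_norm : forall x : H, inner x x = `|x| ^+ 2
}.

#[short(type="hilbertType")]
HB.structure Definition Hilbert (R : realType) :=
  {H of CompleteNormedModule R[i] H & CompleteNormedModule_isHilbert R H}.

Section hilbert.
Context {R : realType} {H : hilbertType R}.
Implicit Types (x y z : H) (a : R[i]).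

Lemma innerDr x y z : inner x (y + z) = inner x y + inner x z.
Proof. by rewrite -{1}[y]scale1r innerPr mul1r. Qed.

Lemma inner0r x : inner x 0 = 0.
Proof. by apply: (addrI (inner x 0)); rewrite -innerDr !addr0. Qed.

Lemma innerZr x a y : inner x (a *: y) = a * inner x y.
Proof. by rewrite -[a *: y]addr0 innerPr inner0r addr0. Qed.

Lemma innerNr x y : inner x (- y) = - inner x y.
Proof. by rewrite -scaleN1r innerZr mulN1r. Qed.

Lemma innerBr x y z : inner x (y - z) = inner x y - inner x z.
Proof. by rewrite innerDr innerNr. Qed.

Lemma innerDl x y z : inner (x + y) z = inner x z + inner y z.
Proof. by rewrite innerC innerDr rmorphD/= -!innerC. Qed.

Lemma innerZl a x y : inner (a *: x) y = conjc a * inner x y.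
Proof. by rewrite innerC innerZr rmorphM/= -innerC. Qed.

Lemma inner_sumr x (I : Type) (s : seq I) (F : I -> H) :
  inner x (\sum_(i <- s) F i) = \sum_(i <- s) inner x (F i).
Proof.
by elim/big_rec2: _ => [|i u v _ <-]; rewrite ?inner0r ?innerDr.
Qed.

Lemma inner_CauchySchwarz x y : `|inner x y| <= `|x| * `|y|.
Proof.
have [->|x0] := eqVneq x 0.
  by rewrite innerC inner0r rmorph0 !normr0 mul0r.
have nx0 : `|x| ^+ 2 != 0 by rewrite expf_neq0// normr_eq0.
pose a := inner x y / `|x| ^+ 2; pose u := y - a *: x.
have xu : inner x u = 0 by rewrite innerBr innerZr inner_norm divfK ?subrr.
have ux : inner u x = 0 by rewrite innerC xu rmorph0.
have yE : `|y| ^+ 2 = `|u| ^+ 2 + `|a| ^+ 2 * `|x| ^+ 2.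
  have -> : y = u + a *: x by rewrite subrK.
  clearbody u a; rewrite -!inner_norm.
  rewrite !(innerDr, innerDl, innerZr, innerZl) xu ux.
  by rewrite !mulr0 addr0 add0r mulrA -sqr_normc.
rewrite -(ler_pXn2r (n := 2)) ?nnegrE ?mulr_ge0// exprMn yE mulrDr.
have -> : `|inner x y| = `|a| * `|x| ^+ 2.
  by rewrite -[X in _ * X]ger0_norm ?exprn_ge0// -normrM divfK.
rewrite exprMn [X in _ <= _ + X]mulrCA -[X in _ <= _ + _ * X]expr2.
by rewrite lerDr mulr_ge0 ?exprn_ge0.
Qed.

(* R[i]^o is R[i] as a normed module over itself, hence as a topological
   space. *)
Lemma inner_continuous x : continuous (inner x : H -> R[i]^o).
Proof.
move=> y; apply/cvgrPdist_le => /= e e0; near=> z.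
rewrite -innerBr (le_trans (inner_CauchySchwarz _ _))//.
have x1 : 0 < `|x| + 1 :> R[i] by rewrite ltr_wpDl.
rewrite (@le_trans _ _ ((`|x| + 1) * `|y - z|))// ?ler_wpM2r ?lerDl//.
rewrite -ler_pdivlMl// mulrC; near: z.
by apply: cvgr_dist_le; [exact: cvg_id|rewrite divr_gt0].
Unshelve. all: by end_near. Qed.

End hilbert.

Section operators.
Context {R : realType} (H : hilbertType R).

Record bounded_operator := BoundedOperator {
  bounded_operator_fun :> {linear H -> H} ;
  bounded_operator_bounded : exists M : R, forall x,
    `|bounded_operator_fun x| <= M%:C * `|x|
}.

Definition orthogonal_projection (T : bounded_operator) :=
  (forall x, T (T x) = T x) /\ (forall x y, inner (T x) y = inner x (T y)).

(* A map op_dom -> H is given by a total function of which only the values on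
   op_dom are relevant; see op_eq. *)
Record partial_operator := PartialOperator {
  op_dom : set H ;
  op_fun :> H -> H
}.

Definition op_eq (A B : partial_operator) :=
  op_dom A = op_dom B /\ forall x, op_dom A x -> A x = B x.

Record unbounded_operator := UnboundedOperator {
  unbounded_operator_op :> partial_operator ;
  op_dom0 : op_dom unbounded_operator_op 0 ;
  op_domP : forall a x y,
    op_dom unbounded_operator_op x -> op_dom unbounded_operator_op y ->
    op_dom unbounded_operator_op (a *: x + y) ;
  op_linear : forall a x y,
    op_dom unbounded_operator_op x -> op_dom unbounded_operator_op y ->
    unbounded_operator_op (a *: x + y) =
      a *: unbounded_operator_op x + unbounded_operator_op y ;
  op_dense : dense (op_dom unbounded_operator_op)
}.

(* For x in the domain the vector z exists by Riesz's theorem and is unique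
   because A is densely defined. *)
Definition adjoint (A : unbounded_operator) : partial_operator :=
  PartialOperator
    [set x | exists M : R, forall y, op_dom A y ->
               `|inner x (A y)| <= M%:C * `|y|]
    (fun x => xget 0 [set z | forall y, op_dom A y ->
                                inner z y = inner x (A y)]).

Definition self_adjoint (A : unbounded_operator) := op_eq A (adjoint A).

End operators.

Section complex_measures.
Context d {X : measurableType d} {R : realType}.

Record complex_measure := ComplexMeasure {
  cmeas_fun :> set X -> R[i]^o ;
  cmeas0 : cmeas_fun set0 = 0 ;
  cmeas_sigma_additive : forall F : nat -> set X,
    (forall n, measurable (F n)) -> trivIset setT F ->
    (fun n => \sum_(0 <= k < n) cmeas_fun (F k))%R @ \oo -->
      cmeas_fun (\bigcup_n F n)
}.

Definition re_charge (nu : complex_measure) (A : set X) : \bar R :=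
  (complex.Re (nu A))%:E.

Definition im_charge (nu : complex_measure) (A : set X) : \bar R :=
  (complex.Im (nu A))%:E.

Let Re_continuous : continuous (@complex.Re R : R[i]^o -> R).
Proof.
move=> z.
apply/(@cvgrPdist_le _ _ _ _ (nbhs_filter (z : R[i]^o))) => /= e e0.
have e0C : 0 < e%:C by rewrite ltcR.
have /(_ _ e0C) := @cvgr_dist_le _ R[i]^o _ _ (nbhs_filter (z : R[i]^o))
  id z (@cvg_id _ _).
apply: filterS => w /= zw; rewrite -lecR (le_trans _ zw)//.
by apply: le_trans (normc_ge_Re _); case: z {zw} w => [? ?] [? ?].
Qed.

Let Im_continuous : continuous (@complex.Im R : R[i]^o -> R).
Proof.
move=> z.
have -> : @complex.Im R = (fun w => complex.Re (w * - 'i%C)).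
  by apply/funext => -[a b]; rewrite mulrN /= mulr0 mulr1 sub0r opprK.
apply: (@continuous_comp _ _ _ (fun w : R[i]^o => (w * - 'i%C : R[i]^o))).
  exact: (@mulrr_continuous (R[i]^o)).
exact: Re_continuous.
Unshelve. all: by end_near. Qed.

Variable nu : complex_measure.

Let part_sigma_additive (g : R[i]^o -> R) :
  (forall a b : R[i], g (a + b) = g a + g b) -> g 0 = 0%R ->
  continuous g -> semi_sigma_additive (fun A => (g (nu A))%:E).
Proof.
move=> gD g0 gc F mF tF _.
rewrite (_ : (fun n => _) =
    EFin \o (g \o (fun n => \sum_(0 <= k < n) nu (F k)))).
  apply: cvg_EFin => /=; first by near=> n.
  exact: (cvg_comp _ _ (cmeas_sigma_additive mF tF) (gc _)).
apply/funext => n /=; rewrite sumEFin; congr _%:E.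
exact/esym/(big_morph g gD g0).
Unshelve. all: by end_near. Qed.

Let re0 : re_charge nu set0 = 0%E.
Proof. by rewrite /re_charge cmeas0. Qed.

Let re_sigma_additive : semi_sigma_additive (re_charge nu).
Proof.
by apply: part_sigma_additive => [[? ?] [? ?]||]//; exact: Re_continuous.
Qed.

HB.instance Definition _ := isCharge.Build _ _ _ (re_charge nu)
  re0 (fun _ _ => isT) re_sigma_additive.

Let im0 : im_charge nu set0 = 0%E.
Proof. by rewrite /im_charge cmeas0. Qed.

Let im_sigma_additive : semi_sigma_additive (im_charge nu).
Proof.
by apply: part_sigma_additive => [[? ?] [? ?]||]//; exact: Im_continuous.
Qed.

HB.instance Definition _ := isCharge.Build _ _ _ (im_charge nu)
  im0 (fun _ _ => isT) im_sigma_additive.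

End complex_measures.
Arguments complex_measure {d} X R.

Section complex_integral.
Context d {X : measurableType d} {R : realType}.
Implicit Types f : X -> R[i].

Definition mintegral (mu : {measure set X -> \bar R}) f : R[i] :=
  (\int[mu]_(t in setT) complex.Re (f t)) +i*
  (\int[mu]_(t in setT) complex.Im (f t)).

(* Integral against a signed measure, through its Jordan decomposition; by
   uniqueness of the latter the choice of a Hahn decomposition is
   irrelevant. *)
Definition charge_integral (nu : {charge set X -> \bar R}) f : R[i] :=
  let P := cid (Hahn_decomposition nu) in
  let N := cid (projT2 P) in
  mintegral (jordan_pos (projT2 N)) f - mintegral (jordan_neg (projT2 N)) f.

Definition cintegral (nu : complex_measure X R) f : R[i] :=
  charge_integral (re_charge nu) f + 'i * charge_integral (im_charge nu) f.

End complex_integral.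

Section projection_valued_measures.
Context d {X : measurableType d} {R : realType} {H : hilbertType R}.

(* The values of P outside the sigma-algebra are irrelevant. *)
Record projection_valued_measure := ProjectionValuedMeasure {
  pvm_fun :> set X -> bounded_operator H ;
  pvm_projection : forall A, measurable A -> orthogonal_projection (pvm_fun A) ;
  pvm0 : forall x, pvm_fun set0 x = 0 ;
  pvmT : forall x, pvm_fun setT x = x ;
  pvm_sigma_additive : forall F : nat -> set X,
    (forall n, measurable (F n)) -> trivIset setT F ->
    forall x, (fun n => \sum_(0 <= k < n) pvm_fun (F k) x) @ \oo -->
                pvm_fun (\bigcup_n F n) x
}.

Variable P : projection_valued_measure.

Section pvm_complex_measure.
Variables x y : H.

Let mu (A : set X) : R[i]^o := inner y (P A x).

Let mu0 : mu set0 = 0.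
Proof. by rewrite /mu pvm0 inner0r. Qed.

Let mu_sigma_additive (F : nat -> set X) :
  (forall n, measurable (F n)) -> trivIset setT F ->
  (fun n => \sum_(0 <= k < n) mu (F k)) @ \oo --> mu (\bigcup_n F n).
Proof.
move=> mF tF.
rewrite (_ : (fun n => _) =
    (inner y : H -> R[i]^o) \o (fun n => \sum_(0 <= k < n) P (F k) x)).
  exact: (cvg_comp _ _ (@pvm_sigma_additive P F mF tF x)
    (@inner_continuous _ _ y _)).
by apply/funext => n /=; rewrite inner_sumr.
Qed.

Definition pvm_cmeasure : complex_measure X R :=
  ComplexMeasure mu0 mu_sigma_additive.

End pvm_complex_measure.

(* The positive measure pvm_cmeasure x x, set to 0 outside the
   sigma-algebra. *)
Definition pvm_measure (x : H) (A : set X) : \bar R :=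
  if A \in measurable then (complex.Re (pvm_cmeasure x x A))%:E else 0%E.

Section pvm_measure.
Variable x : H.

Let mu0 : pvm_measure x set0 = 0%E.
Proof. by rewrite /pvm_measure mem_set//= pvm0 inner0r. Qed.

Let mu_ge0 A : (0 <= pvm_measure x A)%E.
Proof.
rewrite /pvm_measure; case: ifPn => // /[1!inE] mA.
have [PP Psa] := pvm_projection P mA.
rewrite lee_fin /= -(PP x) -Psa inner_norm -lecR.
by rewrite RRe_real ?ger0_real ?exprn_ge0.
Qed.

Let mu_sigma_additive : semi_sigma_additive (pvm_measure x).
Proof.
move=> F mF tF mUF; rewrite /pvm_measure (mem_set mUF).
under eq_fun do under eq_bigr do rewrite (mem_set (mF _)).
exact: (@charge_semi_sigma_additive _ _ _ (re_charge (pvm_cmeasure x x))).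
Qed.

HB.instance Definition _ := isMeasure.Build _ _ _ (pvm_measure x)
  mu0 mu_ge0 mu_sigma_additive.

End pvm_measure.

(* For f measurable and x in the domain, f is integrable with respect to
   pvm_cmeasure x y for all y, and the vector z exists and is unique. *)
Definition pvm_integral (f : X -> R[i]) : partial_operator H :=
  PartialOperator
    [set x | (\int[pvm_measure x]_(t in setT)
                (complex.Re (`|f t| ^+ 2))%:E < +oo)%E]
    (fun x => xget 0 [set z | forall y,
                        inner y z = cintegral (pvm_cmeasure x y) f]).

End projection_valued_measures.
Arguments projection_valued_measure {d} X {R} H.

(* Main.v *)
From HB Require Import structures.
Require Import Defs.
From mathcomp Require Import all_boot all_order all_algebra.
From mathcomp Require Import all_classical all_reals all_analysis.
From mathcomp Require Import measurable_realfun.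
From mathcomp Require Import complex ring lra.

Set Implicit Arguments.
Unset Strict Implicit.
Unset Printing Implicit Defensive.
Import Order.TTheory GRing.Theory Num.Theory.
Import numFieldNormedType.Exports.

Local Open Scope classical_set_scope.
Local Open Scope ring_scope.
Local Open Scope complex_scope.

(** Every self-adjoint A splits H into a part where A <= 0 and a part where
    A >= 0. Indeed, S = A (A^2 + 1)^-1 is a bounded operator which has the sign of
    A, and a bounded S is split by the projection onto the kernel of |S| + S, where
    |S| = sqrt (S^2) is obtained by a convergent iteration (sqrt_exists,
    sign_projection, spectral_split). Splitting A - l for every real l gives
    commuting projections E l, the spectral family (spectral_family_exists), with
    A <= l on the range of E l and A >= l on its complement. These inequalities
    imply that E is increasing, that it is right-continuous in the strong topology,
    that it tends to 0 and to the identity at both ends, and that A differs from l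
    by at most m - l on the range of E m - E l (sf_mono, sf_right_cvg, Eitv_bound).

    For each x the function l |-> |E l x|^2 defines a Stieltjes measure mu x. The
    Borel sets W for which mu x W is, as a function of x, the quadratic form of a
    projection P W are a Dynkin class containing the intervals ]a, b], so they are
    all the Borel sets. As a projection is determined by its quadratic form,
    countable additivity of P follows from that of the measures mu x (pvm_exists).

    It remains to compute integrals. On a bounded interval I, the integral of t
    against <y, P x> is <y, A P_I x>, and that of t^2 against mu x is |A P_I x|^2: the
    difference of the two sides is an additive function of I which is small compared
    to the length of I, so it vanishes by bisection. Exhausting the line by bounded
    intervals yields the domain of A (square_integrable_domain) and its values (first_moment,
    charge_integral_id).

    The analysis takes place in the real Hilbert space underlying H, whose inner
    product dot is the real part of the given one; complex identities are recovered
    by multiplying vectors by i. *)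

(** * The real inner product of a complex Hilbert space *)

Section RealInnerProduct.
Context {R : realType} {H : hilbertType R}.
Implicit Types (x y z w : H) (r : R) (a : R[i]) (u v : nat -> H).

Definition dot x y : R := complex.Re (inner x y).
(** The norm of H has its values in R[i]; nr is the same number seen in R, so
    that estimates are about real numbers. *)
Definition nr x : R := complex.Re `|x|.

Lemma normE x : `|x| = (nr x)%:C.
Proof. by rewrite /nr RRe_real // ger0_real. Qed.

Lemma nr_ge0 x : 0 <= nr x.
Proof. by rewrite -lecR -normE normr_ge0. Qed.

Lemma normr_real_complex r : `|r%:C : R[i]| = `|r|%:C.
Proof. by apply: etrans (normc_def _) _; rewrite /= expr0n addr0 sqrtr_sqr. Qed.

Lemma normr_i : `|'i : R[i]| = 1.
Proof. by apply: etrans (normc_def _) _; rewrite /= expr0n add0r expr1n sqrtr1. Qed.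

Lemma dotxx x : dot x x = nr x ^+ 2.
Proof. by rewrite /dot inner_norm normE -rmorphXn. Qed.

Lemma dotC x y : dot x y = dot y x.
Proof. by rewrite /dot innerC; case: (inner y x). Qed.

Lemma dotDr x y z : dot x (y + z) = dot x y + dot x z.
Proof. by rewrite /dot innerDr raddfD. Qed.

Lemma dotDl x y z : dot (x + y) z = dot x z + dot y z.
Proof. by rewrite dotC dotDr !(dotC z). Qed.

Lemma dotNr x y : dot x (- y) = - dot x y.
Proof. by rewrite /dot innerNr raddfN. Qed.

Lemma dotNl x y : dot (- x) y = - dot x y.
Proof. by rewrite dotC dotNr dotC. Qed.

Lemma dotBr x y z : dot x (y - z) = dot x y - dot x z.
Proof. by rewrite dotDr dotNr. Qed.

Lemma dotBl x y z : dot (x - y) z = dot x z - dot y z.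
Proof. by rewrite dotDl dotNl. Qed.

Lemma dot0r x : dot x 0 = 0.
Proof. by rewrite /dot inner0r. Qed.

Lemma dot0l x : dot 0 x = 0.
Proof. by rewrite dotC dot0r. Qed.

Lemma dotZr x r y : dot x (r%:C *: y) = r * dot x y.
Proof. by rewrite /dot innerZr; case: (inner x y) => p q /=; rewrite mul0r subr0. Qed.

Lemma dotZl x r y : dot (r%:C *: x) y = r * dot x y.
Proof. by rewrite dotC dotZr dotC. Qed.

Lemma dotir x y : dot x ('i *: y) = - complex.Im (inner x y).
Proof. by rewrite /dot innerZr; case: (inner x y) => p q /=; rewrite mul0r mul1r sub0r. Qed.

Lemma dotil x y : dot ('i *: x) y = complex.Im (inner x y).
Proof.
rewrite /dot innerZl; case: (inner x y) => p q /=.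
by rewrite mul0r mulN1r opprK add0r.
Qed.

Lemma dotir_il x y : dot x ('i *: y) = - dot ('i *: x) y.
Proof. by rewrite dotir dotil. Qed.

Lemma ReiZ a x : a *: x = (complex.Re a)%:C *: x + (complex.Im a)%:C *: ('i *: x).
Proof. by rewrite scalerA -scalerDl {1}[a]complexE mulrC [X in _ + X]mulrC. Qed.

Lemma scaler_ii x : 'i *: ('i *: x) = - x.
Proof. by rewrite scalerA -expr2 sqr_i scaleN1r. Qed.

Definition dotE := (dotDr, dotDl, dotBr, dotBl, dotNr, dotNl, dotZr, dotZl,
  dot0r, dot0l).

Lemma dot_inj x y : (forall w, dot w x = dot w y) -> x = y.
Proof.
move=> h; apply/eqP; rewrite -subr_eq0 -normr_eq0 normE.
have : nr (x - y) ^+ 2 == 0 by rewrite -dotxx dotBr h subrr.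
by rewrite sqrf_eq0 => /eqP ->.
Qed.

Lemma nr_eq0 x : nr x = 0 -> x = 0.
Proof. by move=> h; apply/eqP; rewrite -normr_eq0 normE h. Qed.

Lemma nr0 : nr 0 = 0.
Proof. by rewrite /nr normr0. Qed.

Lemma nrN x : nr (- x) = nr x.
Proof. by rewrite /nr normrN. Qed.

Lemma nr_distC x y : nr (x - y) = nr (y - x).
Proof. by rewrite -nrN opprB. Qed.

Lemma nrD x y : nr (x + y) <= nr x + nr y.
Proof. by rewrite -lecR rmorphD /= -!normE ler_normD. Qed.

Lemma nr_dist_triangle x y z : nr (x - z) <= nr (x - y) + nr (y - z).
Proof. by rewrite (_ : x - z = (x - y) + (y - z)) ?nrD// addrA subrK. Qed.

Lemma nrZ r x : nr (r%:C *: x) = `|r| * nr x.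
Proof.
by apply: complexI; rewrite -normE normrZ normE rmorphM /= -normr_real_complex.
Qed.

Lemma nri x : nr ('i *: x) = nr x.
Proof.
apply/eqP; rewrite -(@eqrXn2 _ 2) ?nr_ge0 // -!dotxx dotir_il scaler_ii.
by rewrite dotNl opprK.
Qed.

Lemma nr_sqr_lt x (e : R) : 0 < e -> nr x ^+ 2 < e ^+ 2 -> nr x < e.
Proof. by move=> e0; rewrite ltr_pXn2r // nnegrE ?nr_ge0 // ltW. Qed.

Lemma nrB_sqr x y : nr (x - y) ^+ 2 = nr x ^+ 2 - 2 * dot x y + nr y ^+ 2.
Proof. by rewrite -!dotxx !dotE (dotC y x); ring. Qed.

Lemma nrD_sqr x y : nr (x + y) ^+ 2 = nr x ^+ 2 + 2 * dot x y + nr y ^+ 2.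
Proof. by rewrite -!dotxx !dotE (dotC y x); ring. Qed.

Lemma ler_dot x y : `|dot x y| <= nr x * nr y.
Proof.
rewrite -lecR rmorphM /= -!normE (le_trans _ (inner_CauchySchwarz x y)) //.
exact: normc_ge_Re.
Qed.

Lemma ler_dotW x y : dot x y <= nr x * nr y.
Proof. by rewrite (le_trans (ler_norm _) (ler_dot _ _)). Qed.

Lemma inner_dot x y : inner x y = (dot x y)%:C - (dot x ('i *: y))%:C * 'i.
Proof. by rewrite dotir rmorphN mulNr opprK mulrC -complexE. Qed.

(** Both parts of the inner product are values of dot, the imaginary part
    through multiplication by i; identities between complex inner products thus
    follow from real ones. *)
Lemma inner_dot_eq x y z w : (forall a, dot x (a *: y) = dot z (a *: w)) ->
  inner x y = inner z w.
Proof.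
move=> h; rewrite inner_dot (inner_dot z) h.
by have := h 1; rewrite !scale1r => ->.
Qed.

Lemma norm_innerW x y : `|inner x y| <= (`|dot x y| + `|dot x ('i *: y)|)%:C.
Proof.
rewrite dotir normrN [in leLHS](complexE (inner x y)) (le_trans (ler_normD _ _)) //.
by rewrite normrM normr_i mul1r rmorphD /= /dot !normr_real_complex.
Qed.

(** Convergence with radii in R instead of R[i]; it is the convergence of the
    topology of H by cvgs_cvg. *)
Definition cvgs u x := forall e : R, 0 < e ->
  exists N, forall n, (N <= n)%N -> nr (u n - x) < e.

Lemma cvgs_cvg u x : cvgs u x <-> u @ \oo --> x.
Proof.
split=> [ux|/cvgrPdist_lt ux e e0].
  apply/cvgrPdist_lt => e; case: e => p q /=.
  rewrite ltcE /= => /andP[/eqP -> p0].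
  have [N hN] := ux _ p0; exists N => // n /= Nn.
  by rewrite normE ltcR nr_distC hN.
have e0C : (0 : R[i]) < e%:C by rewrite ltcR.
have [N _ hN] := ux _ e0C; exists N => n Nn.
by have := hN n Nn; rewrite normE ltcR nr_distC.
Qed.

Lemma cauchy_cvgs u : (forall e : R, 0 < e -> exists N, forall n, (N <= n)%N ->
   nr (u n - u N) < e) -> exists x, cvgs u x.
Proof.
move=> uc; suff : cvg (u @ \oo) by move=> /cvg_ex [x ux]; exists x; apply/cvgs_cvg.
apply/cauchy_cvgP/cauchy_exP => e; case: e => p q.
rewrite ltcE /= => /andP[/eqP -> p0].
have [N hN] := uc _ p0; exists (u N); exists N => // n /= Nn.
by rewrite -ball_normE /= normE ltcR nr_distC hN.
Qed.

Lemma cvgs_dot u x y : cvgs u x -> (fun n => dot y (u n)) @ \oo --> dot y x.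
Proof.
move=> ux; apply/cvgrPdist_lt => e e0.
have ny : 0 < nr y + 1 by rewrite ltr_wpDl // nr_ge0.
have [N hN] := ux _ (divr_gt0 e0 ny); exists N => // n /= Nn.
rewrite -dotBr (le_lt_trans (ler_dot _ _)) // nr_distC.
have := hN n Nn; rewrite ltr_pdivlMr // mulrC; apply: le_lt_trans.
by rewrite ler_wpM2r ?nr_ge0 // lerDl.
Qed.

Lemma cvgs_nr u x : cvgs u x -> (fun n => nr (u n)) @ \oo --> nr x.
Proof.
move=> ux; apply/cvgrPdist_lt => e e0; have [N hN] := ux _ e0.
exists N => // n /= Nn; have := hN n Nn; apply: le_lt_trans.
have h1 := nrD (x - u n) (u n); have h2 := nrD (u n - x) x.
rewrite !subrK (nr_distC x) in h1 h2; rewrite ler_norml; lra.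
Qed.

Lemma cvgs_nr_le u x (c : R) : cvgs u x -> (forall n, nr (u n) <= c) -> nr x <= c.
Proof.
move=> /cvgs_nr ux uc; rewrite -(cvg_lim _ ux) //.
by apply: limr_le; [apply: cvgP ux|near=> n; exact: uc].
Unshelve. all: by end_near. Qed.

Lemma cvgs_dot_eq u v x y w z : cvgs u x -> cvgs v y ->
  (forall n, dot w (u n) = dot z (v n)) -> dot w x = dot z y.
Proof.
move=> ux vy e; have := cvgs_dot (y := w) ux.
rewrite (_ : (fun n => _) = (fun n => dot z (v n))); last exact/funext.
by move=> h; apply: (cvg_unique _ h) => //; exact: cvgs_dot.
Qed.

Lemma cvgs_unique u x y : cvgs u x -> cvgs u y -> x = y.
Proof. by move=> ux uy; apply: dot_inj => w; apply: cvgs_dot_eq ux uy _. Qed.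

Lemma cvgs_cst x : cvgs (fun=> x) x.
Proof. by move=> e e0; exists 0%N => n _; rewrite subrr nr0. Qed.

Lemma cvgsD u v x y : cvgs u x -> cvgs v y -> cvgs (fun n => u n + v n) (x + y).
Proof.
move=> ux vy e e0; have e20 : 0 < e / 2 by lra.
have [N hN] := ux _ e20; have [M hM] := vy _ e20.
exists (maxn N M) => n; rewrite geq_max => /andP[/hN h1 /hM h2].
rewrite opprD addrACA (le_lt_trans (nrD _ _)) //; lra.
Qed.

Lemma cvgs_lip u x (T : H -> H) (c : R) : (forall y z, T (y - z) = T y - T z) ->
  (forall y, nr (T y) <= c * nr y) -> cvgs u x -> cvgs (T \o u) (T x).
Proof.
move=> TB Tc ux e e0; have c0 : 0 < `|c| + 1 by rewrite ltr_wpDl.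
have [N hN] := ux _ (divr_gt0 e0 c0); exists N => n Nn /=.
have := hN n Nn; rewrite ltr_pdivlMr // -TB; apply: le_lt_trans.
rewrite (le_trans (Tc _)) // mulrC ler_wpM2l ?nr_ge0 //.
by rewrite (le_trans (ler_norm _)) // lerDl.
Qed.

Lemma invn_pos n : 0 < n.+1%:R^-1 :> R. Proof. by rewrite invr_gt0. Qed.

Lemma invn_small (e : R) : 0 < e -> exists N, forall n, (N <= n)%N -> n.+1%:R^-1 < e.
Proof.
move=> e0; have [N _ hN] := near_infty_natSinv_lt (PosNum e0).
by exists N => n /hN.
Qed.

Lemma cvgs_approx u x : (forall n, nr (u n - x) < n.+1%:R^-1) -> cvgs u x.
Proof.
move=> h e e0; exists (Num.truncn e^-1) => n Nn; apply: (lt_trans (h n)).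
rewrite -[ltRHS]invrK ltf_pV2 ?posrE ?invr_gt0 //.
by rewrite (lt_le_trans (truncnS_gt _)) // ler_nat.
Qed.

End RealInnerProduct.

(** * Riesz representation on a subspace *)

Section Riesz.
Context {R : realType} {H : hilbertType R}.
Implicit Types (x y z w : H) (r : R) (a : R[i]) (u v : nat -> H).

(** This is how the first variation of a quadratic functional is seen to vanish
    at a minimum. *)
Lemma lin_le_sqr (b c : R) : (forall t : R, t * b <= t ^+ 2 * c) -> b = 0.
Proof.
move=> h; have [//|b0] := eqVneq b 0.
have c0 : 0 <= c by have := h 1; have := h (-1); lra.
have := h (b / (c + 1)); have c1 : 0 < c + 1 by lra.
rewrite -subr_ge0.
have -> : (b / (c + 1)) ^+ 2 * c - b / (c + 1) * b = - (b / (c + 1)) ^+ 2.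
  by field; rewrite gt_eqF.
rewrite oppr_ge0 => h2; have : (b / (c + 1)) ^+ 2 == 0.
  by rewrite eq_le h2 sqr_ge0.
by rewrite sqrf_eq0 mulf_eq0 invr_eq0 (gt_eqF c1) orbF => /eqP.
Qed.

(** A minimizing sequence of J y = |y|^2 - 2 phi y on V is Cauchy by the
    parallelogram law, and the first variation of J vanishes at its limit. For V
    the domain of an operator this produces the values of the adjoint, and for V
    a closed subspace it produces the orthogonal projection onto V. *)
Lemma Riesz_subspace (V : set H) (phi : H -> R) (M : R) :
  V 0 -> (forall r x y, V x -> V y -> V (r%:C *: x + y)) ->
  (forall r x y, V x -> V y -> phi (r%:C *: x + y) = r * phi x + phi y) ->
  (forall x, V x -> phi x <= M * nr x) ->
  exists z, (exists2 v, forall n, V (v n) & cvgs v z) /\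
    forall y, V y -> dot z y = phi y.
Proof.
move=> V0 VP phiP phiM.
pose J y := nr y ^+ 2 - 2 * phi y.
have Jlb y : V y -> - M ^+ 2 <= J y.
  move=> /phiM h; rewrite /J; have := sqr_ge0 (nr y - M); rewrite sqrrB.
  by rewrite -[X in _ - X + _]mulr_natl; lra.
pose d := inf (J @` V).
have hI : has_inf (J @` V).
  split; first by exists (J 0), 0.
  by exists (- M ^+ 2) => _ [y Vy <-]; exact: Jlb.
have dJ y : V y -> d <= J y by move=> Vy; apply: ge_inf; [case: hI|exists y].
have /choice [v hv] n : exists y, V y /\ J y < d + n.+1%:R^-1.
  have n0 : 0 < n.+1%:R^-1 :> R by rewrite invr_gt0.
  by have [_ [y Vy <-] hy] := inf_adherent n0 hI; exists y.
clearbody d.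
have midpoint y y' : V y -> V y' -> nr (y - y') ^+ 2 <= 2 * (J y + J y' - 2 * d).
  move=> Vy Vy'; pose w := (2^-1)%:C *: y + ((2^-1)%:C *: y' + 0).
  have Vy'2 : V ((2^-1)%:C *: y' + 0) by exact: VP.
  have := dJ w (VP _ _ _ Vy Vy'2).
  rewrite nrB_sqr /J /w !phiP // addr0 nrD_sqr !nrZ !dotE !exprMn.
  have -> : phi 0 = 0.
    by have := phiP 1 0 0 V0 V0; rewrite scaler0 addr0; lra.
  rewrite ger0_norm //; lra.
have [z vz] : exists z, cvgs v z.
  apply: cauchy_cvgs => e e0.
  have e20 : 0 < e ^+ 2 / 4 by rewrite divr_gt0 ?exprn_gt0.
  have [N hN] := invn_small e20.
  exists N => n Nn; apply: nr_sqr_lt => //.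
  have [Vn Jn] := hv n; have [VN JN] := hv N.
  apply: (le_lt_trans (midpoint _ _ Vn VN)).
  move: Jn JN (hN n Nn) (hN N (leqnn N)).
  move: (J (v n)) (J (v N)) (n.+1%:R^-1 : R) (N.+1%:R^-1 : R) => *; lra.
exists z; split; first by exists v => // n; case: (hv n).
move=> y Vy; apply/eqP; rewrite -subr_eq0; apply/eqP.
apply: (@lin_le_sqr _ (nr y ^+ 2 / 2)) => t.
have h (s : R) n : - (n.+1%:R^-1) <= 2 * s * (dot (v n) y - phi y) + s ^+ 2 * nr y ^+ 2.
  have [Vn Jn] := hv n; have := dJ _ (VP s _ _ Vy Vn).
  rewrite /J phiP // nrD_sqr nrZ dotE exprMn real_normK ?num_real //.
  move: Jn; rewrite /J (dotC (v n)); move: (n.+1%:R^-1 : R) => q; lra.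
have : 0 <= 2 * - t * (dot z y - phi y) + t ^+ 2 * nr y ^+ 2.
  pose f n : R := 2 * - t * (dot y (v n) - phi y) + t ^+ 2 * nr y ^+ 2 + n.+1%:R^-1.
  have fl : f @ \oo --> 2 * - t * (dot y z - phi y) + t ^+ 2 * nr y ^+ 2 + 0.
    apply: cvgD; last exact: cvg_harmonic.
    apply: cvgD; last exact: cvg_cst.
    by apply: cvgMr; apply: cvgB; [exact: cvgs_dot|exact: cvg_cst].
  rewrite -[leRHS]addr0 (dotC z) -(cvg_lim _ fl) //.
  apply: limr_ge; first by apply: cvgP fl.
  near=> n; have := h (- t) n.
  by rewrite /f (dotC y) sqrrN; move: (n.+1%:R^-1 : R) => q; lra.
rewrite mulrN; lra.
Unshelve. all: by end_near. Qed.

End Riesz.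

(** * Orthogonal projections *)

Section Projections.
Context {R : realType} {H : hilbertType R}.
Implicit Types (x y z w : H) (r : R) (a : R[i]) (u v : nat -> H) (S T E Q : H -> H).

Definition clinear T := forall a x y, T (a *: x + y) = a *: T x + T y.
Definition dsymmetric T := forall x y, dot (T x) y = dot x (T y).

Lemma clin0 T : clinear T -> T 0 = 0.
Proof.
move=> Tl; apply/eqP; rewrite -(addrK (T 0) (T 0)) subr_eq0.
by rewrite -{1}[T 0]scale1r -Tl scaler0 addr0.
Qed.

Lemma clinD T x y : clinear T -> T (x + y) = T x + T y.
Proof. by move=> Tl; rewrite -[x in LHS]scale1r Tl scale1r. Qed.

Lemma clinZ T a x : clinear T -> T (a *: x) = a *: T x.
Proof. by move=> Tl; rewrite -[X in T X]addr0 Tl clin0 // addr0. Qed.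

Lemma clinN T x : clinear T -> T (- x) = - T x.
Proof. by move=> Tl; rewrite -scaleN1r clinZ // scaleN1r. Qed.

Lemma clinB T x y : clinear T -> T (x - y) = T x - T y.
Proof. by move=> Tl; rewrite clinD // clinN. Qed.

Lemma clinear_lim (U : nat -> H -> H) T : (forall n, clinear (U n)) ->
  (forall x, cvgs (fun n => U n x) (T x)) -> clinear T.
Proof.
move=> Ul UT a x y; apply: cvgs_unique (UT _) _.
have h1 : cvgs (fun n => a *: U n x) (a *: T x).
  by apply/cvgs_cvg; apply: cvgZl_tmp; apply/cvgs_cvg; exact: UT.
have := cvgsD h1 (UT y); congr cvgs; apply/funext => n.
by rewrite Ul.
Qed.

(** For a complex-linear E, symmetry for the real inner product amounts to
    symmetry for the complex one. *)
Definition isproj E := [/\ clinear E, forall x, E (E x) = E x & dsymmetric E].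

Section isproj_theory.
Variables (E : H -> H) (Ep : isproj E).

Lemma proj_clin : clinear E. Proof. by case: Ep. Qed.
Lemma proj_idem x : E (E x) = E x. Proof. by case: Ep. Qed.
Lemma proj_sym x y : dot (E x) y = dot x (E y). Proof. by case: Ep. Qed.

Lemma proj_dot x : dot x (E x) = nr (E x) ^+ 2.
Proof. by rewrite -[in LHS]proj_idem -proj_sym dotxx. Qed.

Lemma projB x y : E (x - y) = E x - E y.
Proof. exact: clinB proj_clin. Qed.

Lemma projD x y : E (x + y) = E x + E y.
Proof. exact: clinD proj_clin. Qed.

Lemma proj0 : E 0 = 0. Proof. exact: clin0 proj_clin. Qed.

Lemma proj_compl : isproj (fun x => x - E x).
Proof.
split=> [a x y|x|x y].
- by rewrite proj_clin scalerBr opprD addrACA.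
- by rewrite projB proj_idem subrr subr0.
- by rewrite !dotE proj_sym.
Qed.

Lemma proj_pythagoras x : nr x ^+ 2 = nr (E x) ^+ 2 + nr (x - E x) ^+ 2.
Proof. by rewrite nrB_sqr proj_dot; ring. Qed.

Lemma proj_nr x : nr (E x) <= nr x.
Proof.
rewrite -(@ler_pXn2r _ 2) ?nnegrE ?nr_ge0 // [leRHS]proj_pythagoras.
by rewrite lerDl exprn_ge0 ?nr_ge0.
Qed.

Lemma proj_cvgs u x : cvgs u x -> cvgs (E \o u) (E x).
Proof.
apply: (@cvgs_lip _ _ _ _ _ 1) => [y z|y]; first exact: projB.
by rewrite mul1r proj_nr.
Qed.

End isproj_theory.

(** Polarization: a projection is determined by its quadratic form, so that two
    projections can be compared through the measures that they define. *)
Lemma proj_eq E F : isproj E -> isproj F ->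
  (forall x, dot x (E x) = dot x (F x)) -> E =1 F.
Proof.
move=> Ep Fp h x; apply: dot_inj => y.
have := h (x + y); rewrite !(clinD _ _ (proj_clin Ep)) !(clinD _ _ (proj_clin Fp)) !dotE.
have e1 : dot x (E y) = dot y (E x) by rewrite -(proj_sym Ep) dotC.
have e2 : dot x (F y) = dot y (F x) by rewrite -(proj_sym Fp) dotC.
by rewrite e1 e2; have := h x; have := h y; lra.
Qed.

(** Since K is a complex subspace, so is its real orthogonal complement; hence
    the projection for the real inner product is complex-linear. *)
Lemma projection_theorem (K : set H) :
  K 0 -> (forall a x y, K x -> K y -> K (a *: x + y)) ->
  (forall u x, (forall n, K (u n)) -> cvgs u x -> K x) ->
  exists E, [/\ isproj E, forall x, K (E x) & forall x, K x -> E x = x].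
Proof.
move=> K0 KP Kcl.
have KB x y : K x -> K y -> K (x - y).
  by move=> Kx Ky; rewrite addrC -scaleN1r; exact: KP.
have /choice [E hE] x : exists z, K z /\ forall y, K y -> dot z y = dot x y.
  have [] := @Riesz_subspace _ _ K (dot x) (nr x) K0.
  - by move=> r; exact: KP.
  - by move=> r y z _ _; rewrite !dotE.
  - by move=> y _; exact: ler_dotW.
  by move=> z [[v Kv vz] hz]; exists z; split=> //; exact: Kcl vz.
have Kuniq x z : K z -> (forall y, K y -> dot z y = dot x y) -> E x = z.
  move=> Kz hz; have [KE hEx] := hE x.
  apply/eqP; rewrite -subr_eq0; apply/eqP/nr_eq0.
  have KEz := KB _ _ KE Kz.
  have : nr (E x - z) ^+ 2 == 0 by rewrite -dotxx dotBl hEx // hz // subrr.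
  by rewrite sqrf_eq0 => /eqP.
exists E; split=> [|x|x Kx]; last by apply: (Kuniq x x).
  split=> [a x y|x|x y].
  - apply: Kuniq => [|w Kw]; first by apply: KP; [case: (hE x)|case: (hE y)].
    have [_ hx] := hE x; have [_ hy] := hE y.
    have Ki : K ('i *: w) by rewrite -[_ *: _]addr0; exact: KP.
    rewrite ReiZ [a *: x]ReiZ !dotE hy //.
    have il z : dot ('i *: z) w = - dot z ('i *: w) by rewrite dotir_il opprK.
    by rewrite !il !hx.
  - by apply: Kuniq => //; case: (hE x).
  - have [KEx hx] := hE x; have [KEy hy] := hE y.
    by rewrite -hx // dotC -hy // dotC.
by case: (hE x).
Qed.

End Projections.

(** * Square roots of positive operators *)

Section SquareRoot.
Context {R : realType} {H : hilbertType R}.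
Implicit Types (x y z w : H) (r : R) (a : R[i]) (u v : nat -> H) (S T E Q : H -> H).

(** The solution Y of 2 Y = T + Y^2 with Y <= 1 is 1 - sqrt (1 - T); these are
    the Picard iterates of this equation. *)
Fixpoint sqrt_iter T n x : H :=
  if n is m.+1 then (2^-1)%:C *: (T x + sqrt_iter T m (sqrt_iter T m x)) else 0.

(** The iterates for the number 1 in place of T. They increase to 1 and dominate
    the iterates for every contraction. *)
Fixpoint sqrt_bound n : R := if n is m.+1 then (1 + sqrt_bound m ^+ 2) / 2 else 0.

Lemma sqrt_bound01 n : 0 <= sqrt_bound n <= 1.
Proof. elim: n => [|n /andP[h0 h1]] /=; [by rewrite lexx ler01|]; nra. Qed.

Lemma sqrt_bound_nd : {homo sqrt_bound : m n / (m <= n)%N >-> m <= n}.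
Proof.
apply/nondecreasing_seqP => n /=; have := sqr_ge0 (1 - sqrt_bound n); rewrite sqrrB; lra.
Qed.

Lemma sqrt_bound_cauchy (e : R) : 0 < e -> exists N, forall n, (N <= n)%N ->
  sqrt_bound n - sqrt_bound N < e.
Proof.
move=> e0.
have : cvg (sqrt_bound @ \oo).
  apply: nondecreasing_is_cvgn; first exact: sqrt_bound_nd.
  by exists 1 => _ [n _ <-]; case/andP: (sqrt_bound01 n).
move=> /cvg_ex [l /cvgrPdist_lt hl]; have e20 : 0 < e / 2 by lra.
have [N _ hN] := hl _ e20; exists N => n Nn.
have := hN N (leqnn N); have := hN n Nn => /=; rewrite !ltr_norml; lra.
Qed.

Section Iteration.
Variable T : H -> H.
Hypotheses (Tl : clinear T) (Tsym : dsymmetric T) (T1 : forall x, nr (T x) <= nr x).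

Local Notation Y := (sqrt_iter T).
Local Notation b := sqrt_bound.

Lemma sqrt_iter_clin n : clinear (Y n).
Proof.
elim: n => [|n IH] a x y /=; first by rewrite scaler0 addr0.
rewrite Tl !IH scalerA [a * _]mulrC -scalerA -scalerDr; congr (_ *: _).
by rewrite scalerDr addrACA.
Qed.

Lemma sqrt_iter_sym n : dsymmetric (Y n).
Proof.
elim: n => [|n IH] x y /=; first by rewrite !dotE.
by rewrite !dotE Tsym !IH.
Qed.

Lemma sqrt_iter_nr n x : nr (Y n x) <= b n * nr x.
Proof.
elim: n x => [|n IH] x /=; first by rewrite nr0 mul0r.
rewrite nrZ ger0_norm // ; have /andP[b0 _] := sqrt_bound01 n.
have h1 := nrD (T x) (Y n (Y n x)); have h2 := T1 x.
have h3 := ler_wpM2l b0 (IH x); have h4 := IH (Y n x); lra.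
Qed.

(** Writing Y for the iterates, Y_(n+2) - Y_(n+1) is the half of
    Y_(n+1) (Y_(n+1) - Y_n) + (Y_(n+1) - Y_n) Y_n, and the bounds satisfy the
    same identity: the increments of Y are dominated by those of the bounds,
    which makes the iterates Cauchy. *)
Lemma sqrt_iter_step n x : nr (Y n.+1 x - Y n x) <= (b n.+1 - b n) * nr x.
Proof.
elim: n x => [|n IH] x.
  by rewrite subr0 /= addr0 nrZ ger0_norm //; have := T1 x; lra.
have -> : Y n.+2 x - Y n.+1 x = (2^-1)%:C *: (Y n.+1 (Y n.+1 x - Y n x)
                                  + (Y n.+1 (Y n x) - Y n (Y n x))).
  rewrite (clinB _ _ (sqrt_iter_clin n.+1)) addrA subrK.
  by rewrite -[LHS]/(_ *: (T x + Y n.+1 (Y n.+1 x)) - _ *: _) -scalerBr opprD addrACA subrr add0r.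
rewrite nrZ ger0_norm //.
have h1 := nrD (Y n.+1 (Y n.+1 x - Y n x)) (Y n.+1 (Y n x) - Y n (Y n x)).
have h2 := sqrt_iter_nr n.+1 (Y n.+1 x - Y n x).
have /andP[b0 _] := sqrt_bound01 n.+1.
have h3 := ler_wpM2l b0 (IH x).
have d0 : 0 <= b n.+1 - b n by rewrite subr_ge0 sqrt_bound_nd.
have h4 := IH (Y n x); have h5 := ler_wpM2l d0 (sqrt_iter_nr n x).
have -> : (b n.+2 - b n.+1) * nr x =
  2^-1 * (b n.+1 * ((b n.+1 - b n) * nr x) + (b n.+1 - b n) * (b n * nr x)).
  by rewrite /=; field.
lra.
Qed.

Lemma sqrt_iter_dist n m x : (n <= m)%N -> nr (Y m x - Y n x) <= (b m - b n) * nr x.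
Proof.
elim: m => [|m IH]; first by rewrite leqn0 => /eqP ->; rewrite !subrr nr0 mul0r.
rewrite leq_eqVlt => /orP[/eqP ->|]; first by rewrite !subrr nr0 mul0r.
rewrite ltnS => /IH h; have h1 := sqrt_iter_step m x.
have := nr_dist_triangle (Y m.+1 x) (Y m x) (Y n x); lra.
Qed.

Lemma sqrt_iter_lim : exists Z : H -> H, forall x, cvgs (fun n => Y n x) (Z x).
Proof.
suff h x : exists z, cvgs (fun n => Y n x) z by have /choice [Z] := h; exists Z.
apply: cauchy_cvgs => e e0; have n1 : 0 < nr x + 1 by rewrite ltr_wpDl // nr_ge0.
have [N hN] := sqrt_bound_cauchy (divr_gt0 e0 n1); exists N => n Nn.
apply: (le_lt_trans (sqrt_iter_dist x Nn)).
have := hN n Nn; rewrite ltr_pdivlMr //; apply: le_lt_trans.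
by rewrite ler_wpM2l ?subr_ge0 ?sqrt_bound_nd // lerDl.
Qed.

End Iteration.

(** The root is W = 1 - Y with Y the limit of the iterates. It commutes with the
    operators that commute with T because each iterate does; the adjoint Q' of Q
    lets one pass to the limit under Q inside inner products. *)
Lemma sqrt_exists T : clinear T -> dsymmetric T -> (forall x, nr (T x) <= nr x) ->
  exists W : H -> H, [/\ clinear W, dsymmetric W, forall x, 0 <= dot x (W x),
    forall x, W (W x) = x - T x &
    forall Q Q', clinear Q -> (forall x y, dot (Q x) y = dot x (Q' y)) ->
      (forall x, Q (T x) = T (Q x)) -> forall x, Q (W x) = W (Q x)].
Proof.
move=> Tl Ts T1; have [Z hZ] := sqrt_iter_lim Tl T1.
have Zl : clinear Z := clinear_lim (sqrt_iter_clin Tl) hZ.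
have Zs : dsymmetric Z.
  move=> x y; rewrite dotC; apply: cvgs_dot_eq (hZ x) (hZ y) _ => n.
  by rewrite dotC sqrt_iter_sym.
have Z1 x : nr (Z x) <= nr x.
  apply: cvgs_nr_le (hZ x) _ => n; apply: (le_trans (sqrt_iter_nr T1 n x)).
  by rewrite ler_piMl ?nr_ge0 //; case/andP: (sqrt_bound01 n).
have Zfix x : Z x = (2^-1)%:C *: (T x + Z (Z x)).
  have YYZ : cvgs (fun n => sqrt_iter T n (sqrt_iter T n x)) (Z (Z x)).
    move=> e e0; have e20 : 0 < e / 2 by lra.
    have [N hN] := hZ x _ e20; have [M hM] := hZ (Z x) _ e20.
    exists (maxn N M) => n; rewrite geq_max => /andP[/hN h1 /hM h2].
    have h3 := nr_dist_triangle (sqrt_iter T n (sqrt_iter T n x)) (sqrt_iter T n (Z x)) (Z (Z x)).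
    rewrite -(clinB _ _ (sqrt_iter_clin Tl n)) in h3.
    have h4 := sqrt_iter_nr T1 n (sqrt_iter T n x - Z x).
    have /andP[_ b1] := sqrt_bound01 n.
    have := ler_wpM2r (nr_ge0 (sqrt_iter T n x - Z x)) b1; lra.
  have Ysucc : cvgs (fun n => sqrt_iter T n.+1 x) (Z x).
    by move=> e /(hZ x) [N hN]; exists N => n Nn; apply: hN; apply: leqW.
  apply: cvgs_unique Ysucc _; apply: (@cvgs_lip _ _ (fun n => T x + _) _ (fun y => _ *: y) `|2^-1|).
  - by move=> y z; rewrite scalerBr.
  - by move=> y; rewrite nrZ.
  - by apply: cvgsD YYZ; exact: cvgs_cst.
exists (fun x => x - Z x); split=> [a x y|x y|x|x|Q Q' Ql QQ' QT x].
- by rewrite Zl scalerBr opprD addrACA.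
- by rewrite !dotE Zs.
- by rewrite dotBr dotxx subr_ge0 (le_trans (ler_dotW _ _)) // expr2 ler_wpM2l ?nr_ge0.
- apply: dot_inj => w; rewrite (clinB _ _ Zl) !dotE.
  by rewrite [in dot w (Z x)]Zfix !dotE; field.
- rewrite (clinB _ _ Ql); congr (_ - _); apply: dot_inj => w.
  rewrite dotC QQ' dotC; apply: cvgs_dot_eq (hZ x) (hZ (Q x)) _ => n.
  rewrite dotC -QQ' dotC; congr dot.
  by elim: n x => [|n IH] x /=; [rewrite clin0|rewrite clinZ // clinD // !QT !IH].
Qed.

End SquareRoot.

(** * The projection onto the negative part of a bounded operator *)

Section SignProjection.
Context {R : realType} {H : hilbertType R}.
Implicit Types (x y z w : H) (S T E Q : H -> H).

(** Let W = sqrt (S^2), the absolute value of S. From (W + S) (W - S) = 0 it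
    follows that S = - W on the kernel K of W + S, and that S = W on the
    orthogonal complement of K; E is the projection onto K. *)
Lemma sign_projection S : clinear S -> dsymmetric S -> (forall x, nr (S x) <= nr x) ->
  exists E, [/\ isproj E, forall x, E x = x -> dot x (S x) <= 0,
    forall x, E x = 0 -> 0 <= dot x (S x),
    forall x, S x = 0 -> E x = x &
    forall Q Q', clinear Q -> clinear Q' ->
      (forall x y, dot (Q x) y = dot x (Q' y)) ->
      (forall x, Q (S x) = S (Q x)) -> (forall x, Q' (S x) = S (Q' x)) ->
      forall x, Q (E x) = E (Q x)].
Proof.
move=> Sl Ss S1; pose T x := x - S (S x).
have Tl : clinear T.
  by move=> a x y; rewrite /T !Sl scalerBr opprD addrACA.
have Ts : dsymmetric T by move=> x y; rewrite /T !dotE !Ss.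
have T1 x : nr (T x) <= nr x.
  rewrite -(@ler_pXn2r _ 2) ?nnegrE ?nr_ge0 // /T nrB_sqr -Ss dotxx.
  have : nr (S (S x)) ^+ 2 <= nr (S x) ^+ 2 by rewrite ler_pXn2r ?nnegrE ?nr_ge0.
  have := sqr_ge0 (nr (S x)); lra.
have [W [Wl Ws W0 WW WQ]] := sqrt_exists Tl Ts T1.
have {}WW x : W (W x) = S (S x) by rewrite WW /T opprB addrC subrK.
have TQ Q : clinear Q -> (forall x, Q (S x) = S (Q x)) -> forall x, Q (T x) = T (Q x).
  by move=> Ql QS x; rewrite /T (clinB _ _ Ql) !QS.
have SW x : S (W x) = W (S x) by apply: (WQ _ S) => //; exact: TQ.
pose K := [set x | W x + S x = 0].
have [||u x Ku ux|E [Ep KE EK]] := @projection_theorem _ _ K.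
- by rewrite /K /= (clin0 Wl) (clin0 Sl) addr0.
- by move=> a x y; rewrite /K /= Wl Sl addrACA -scalerDr => -> ->; rewrite scaler0 addr0.
- apply: dot_inj => w; rewrite dotDr -Ws -Ss -dotDl dot0r -(dot0r (W w + S w)).
  apply: cvgs_dot_eq ux (cvgs_cst 0) _ => n.
  by rewrite dot0r dotDl Ws Ss -dotDr (Ku n) dot0r.
(* K contains the range of W - S, hence W - S vanishes on the complement of K *)
have KWS x : K (W x - S x).
  rewrite /K /= (clinB _ _ Wl) (clinB _ _ Sl) WW SW.
  by rewrite addrA subrK subrr.
exists E; split=> // [x Ex|x Ex|x Sx|Q Q' Ql Q'l QQ' QS Q'S x].
- have : K x by rewrite -Ex; exact: KE.
  move=> /eqP; rewrite /K /= addrC addr_eq0 => /eqP ->.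
  by rewrite dotNr oppr_le0.
- have v0 : W x - S x = 0.
    apply: nr_eq0; apply/eqP; rewrite -sqrf_eq0 -dotxx.
    rewrite dotBl Ws Ss -dotBr.
    rewrite -[X in dot x X](EK _ (KWS _)).
    by rewrite -(proj_sym Ep) Ex dot0l.
  have /eqP := v0; rewrite subr_eq0 => /eqP <-; exact: W0.
- apply: EK; rewrite /K /= Sx addr0; apply: nr_eq0; apply/eqP.
  by rewrite -sqrf_eq0 -dotxx Ws WW Sx (clin0 Sl) dot0r.
have KQ (P P' : H -> H) : clinear P -> (forall x y, dot (P x) y = dot x (P' y)) ->
    (forall x, P (S x) = S (P x)) -> forall x, K x -> K (P x).
  move=> Pl PP' PS y Ky; rewrite /K /= -PS -(WQ P P') //; last exact: TQ.
  by rewrite -(clinD _ _ Pl) Ky (clin0 Pl).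
have Qx : Q x = Q (E x) + Q (x - E x) by rewrite -(clinD _ _ Ql) addrC subrK.
rewrite Qx (projD Ep) (EK (Q (E x))); last by apply: (KQ _ Q') => //; exact: KE.
suff -> : E (Q (x - E x)) = 0 by rewrite addr0.
apply: dot_inj => w; rewrite dot0r -(proj_sym Ep) dotC QQ' dotC.
have Q'Q y z : dot (Q' y) z = dot y (Q z) by rewrite dotC -QQ' dotC.
rewrite -(EK (Q' (E w))); last by apply: (KQ _ Q) => //; exact: KE.
by rewrite (proj_sym Ep) (projB Ep) (proj_idem Ep) subrr dot0r.
Qed.

End SignProjection.

Lemma scale_clin {R : realType} {H : hilbertType R} (c : R[i]) :
  clinear (fun x : H => c *: x).
Proof. by move=> a x y /=; rewrite scalerDr !scalerA mulrC. Qed.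

(** * Self-adjoint operators and their resolvents *)

Section SelfAdjoint.
Context {R : realType} {H : hilbertType R}.
Implicit Types (x y z w : H) (r s : R) (D : set H) (A S T E Q : H -> H).

(** Self-adjointness for the real inner product. The last clause says that the
    domain of the adjoint is contained in D. *)
Record selfadj D A : Prop := Selfadj {
  sa0 : D 0;
  saP : forall a x y, D x -> D y -> D (a *: x + y);
  saL : forall a x y, D x -> D y -> A (a *: x + y) = a *: A x + A y;
  sa_dense : forall x, exists2 u, forall n, D (u n) & cvgs u x;
  sa_sym : forall x y, D x -> D y -> dot (A x) y = dot x (A y);
  sa_max : forall x M, (forall y, D y -> dot x (A y) <= M * nr y) -> D x
}.

(** Q A is contained in A Q, the meaning of commutation of a bounded operator Q
    with an unbounded one. *)
Definition commutes D A Q := forall x, D x -> D (Q x) /\ A (Q x) = Q (A x).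

Definition opshift A r x := A x - r%:C *: x.

(** The operator (A + s i)^-1. *)
Definition resolvent D A s x :=
  xget 0 [set u | D u /\ A u + s%:C *: ('i *: u) = x].

Section Theory.
Variables (D : set H) (A : H -> H) (sa : selfadj D A).

Lemma saD x y : D x -> D y -> D (x + y).
Proof. by move=> Dx Dy; rewrite -[x]scale1r; exact: (saP sa). Qed.

Lemma saZ a x : D x -> D (a *: x).
Proof. by move=> Dx; rewrite -[_ *: _]addr0; apply: (saP sa) => //; exact: (sa0 sa). Qed.

Lemma saB x y : D x -> D y -> D (x - y).
Proof. by move=> Dx Dy; rewrite -scaleN1r; apply: saD => //; exact: saZ. Qed.

Lemma sa_op0 : A 0 = 0.
Proof.
have := saL sa 1 (sa0 sa) (sa0 sa); rewrite !scale1r addr0 => /eqP.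
by rewrite -subr_eq0 opprD addrA subrr add0r oppr_eq0 => /eqP.
Qed.

Lemma sa_opZ a x : D x -> A (a *: x) = a *: A x.
Proof.
by move=> Dx; rewrite -[_ *: x]addr0 (saL sa) ?sa_op0 ?addr0 //; exact: (sa0 sa).
Qed.

Lemma sa_opD x y : D x -> D y -> A (x + y) = A x + A y.
Proof. by move=> Dx Dy; rewrite -[x]scale1r (saL sa) // !scale1r. Qed.

Lemma sa_opB x y : D x -> D y -> A (x - y) = A x - A y.
Proof. by move=> Dx Dy; rewrite -[in LHS]scaleN1r addrC (saL sa) // scaleN1r addrC. Qed.

Lemma sa_dense_eq x y : (forall z, D z -> dot x z = dot y z) -> x = y.
Proof.
move=> h; apply: dot_inj => w; have [u Du uw] := sa_dense sa w.
by rewrite dotC [RHS]dotC; apply: (cvgs_dot_eq (u := u) (v := u)) => // n; exact: h.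
Qed.

Lemma sa_maxE x z : (forall y, D y -> dot x (A y) = dot z y) -> D x /\ A x = z.
Proof.
move=> h; have Dx : D x.
  by apply: (sa_max sa (M := nr z)) => y Dy; rewrite h // ler_dotW.
by split=> //; apply: sa_dense_eq => y Dy; rewrite (sa_sym sa) // h.
Qed.

Lemma sa_closed u x z : (forall n, D (u n)) -> cvgs u x -> cvgs (A \o u) z ->
  D x /\ A x = z.
Proof.
move=> Du ux Auz; apply: sa_maxE => y Dy; rewrite dotC (dotC z).
by apply: cvgs_dot_eq ux Auz _ => n /=; rewrite dotC -(sa_sym sa) // dotC.
Qed.

Lemma sa_shift r : selfadj D (opshift A r).
Proof.
split; first exact: (sa0 sa).
- exact: (saP sa).
- move=> a x y Dx Dy; rewrite /opshift (saL sa) // scalerDr !scalerBr !scalerA.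
  by rewrite [a * _]mulrC opprD addrACA.
- exact: (sa_dense sa).
- by move=> x y Dx Dy; rewrite /opshift !dotE (sa_sym sa).
- move=> x M hM; apply: (sa_max sa (M := M + `|r| * nr x)) => y Dy.
  have := hM y Dy; rewrite /opshift !dotE => h.
  have h1 := ler_norm (r * dot x y); rewrite normrM in h1.
  have h2 := ler_wpM2l (normr_ge0 r) (ler_dot x y); lra.
Qed.

Lemma dot_op_i x : D x -> dot (A x) ('i *: x) = 0.
Proof.
move=> Dx; have := sa_sym sa Dx (saZ 'i Dx).
by rewrite sa_opZ // (dotir_il x) (dotC _ (A x)); lra.
Qed.

Lemma nr_shift_i s x : D x ->
  nr (A x + s%:C *: ('i *: x)) ^+ 2 = nr (A x) ^+ 2 + s ^+ 2 * nr x ^+ 2.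
Proof.
by move=> Dx; rewrite nrD_sqr dotE dot_op_i // nrZ nri exprMn real_normK ?num_real //; ring.
Qed.

(** By nr_shift_i, A + s i is bounded below and so has a closed range. If w is
    orthogonal to the range, then A w = s i w by maximality of the domain, which
    is only possible for w = 0, as dot (A w) ('i *: w) = 0. *)
Lemma range_shift_i s x : s ^+ 2 = 1 -> exists u, D u /\ A u + s%:C *: ('i *: u) = x.
Proof.
move=> s1; pose B u := A u + s%:C *: ('i *: u).
have BL a u v : D u -> D v -> B (a *: u + v) = a *: B u + B v.
  by move=> Du Dv; rewrite /B (saL sa) // !scale_clin scalerDr addrACA.
have B0 : B 0 = 0 by rewrite /B sa_op0 !scaler0 addr0.
pose V := B @` D.
have [] := @Riesz_subspace _ _ V (dot x) (nr x).
- by exists 0 => //; exact: (sa0 sa).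
- by move=> r _ _ [u Du <-] [v Dv <-]; exists (r%:C *: u + v); rewrite ?BL //; exact: (saP sa).
- by move=> r y z _ _; rewrite !dotE.
- by move=> y _; exact: ler_dotW.
move=> z [[v Vv vz] hz].
(* x - z is orthogonal to the range *)
have zx : z = x.
  apply/eqP; rewrite -subr_eq0; apply/eqP.
  have : forall y, D y -> dot (z - x) (A y) = dot (s%:C *: ('i *: (z - x))) y.
    move=> y Dy; have := hz _ (imageP B Dy); rewrite /B !dotE => e.
    have -> : dot ('i *: (z - x)) y = - dot (z - x) ('i *: y) by rewrite dotir_il opprK.
    by rewrite !dotE; lra.
  move=> /sa_maxE [Dw Aw].
  have := dot_op_i Dw; rewrite Aw dotE dotxx nri => /eqP.
  rewrite mulf_eq0 sqrf_eq0 => /orP[/eqP s0|/eqP]; last exact: nr_eq0.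
  by move: s1; rewrite s0 expr0n /= => /eqP; rewrite eq_sym oner_eq0.
have /choice [u hu] n : exists u, D u /\ B u = v n.
  by have [u Du <-] := Vv n; exists u.
(* the range is closed: preimages of a Cauchy sequence are Cauchy *)
have nru n m : nr (u n - u m) <= nr (v n - v m).
  rewrite -(@ler_pXn2r _ 2) ?nnegrE ?nr_ge0 //.
  have [Dn <-] := hu n; have [Dm <-] := hu m.
  have -> : B (u n) - B (u m) = B (u n - u m).
    rewrite -[in RHS](scaleN1r (u m)) addrC [in RHS]addrC BL // scaleN1r //.
  rewrite nr_shift_i; last exact: saB.
  by rewrite s1 mul1r lerDr exprn_ge0 ?nr_ge0.
have [w uw] : exists w, cvgs u w.
  apply: cauchy_cvgs => e e0; have e20 : 0 < e / 2 by lra.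
  have [N hN] := vz _ e20; exists N => n Nn.
  have := nru n N; have := hN _ Nn; have := hN _ (leqnn N).
  have := nr_dist_triangle (v n) z (v N); rewrite (nr_distC z); lra.
have Auw : cvgs (A \o u) (x - s%:C *: ('i *: w)).
  have -> : A \o u = (fun n => v n + (- s%:C) *: ('i *: u n)).
    apply/funext => n /=; have [_ <-] := hu n.
    by rewrite /B scaleNr addrK.
  rewrite -scaleNr; apply: cvgsD; first by rewrite -zx.
  apply: (@cvgs_lip _ _ u w (fun y => (- s%:C) *: ('i *: y)) `|s| _ _ uw).
  - by move=> y y'; rewrite !scalerBr.
  - by move=> y; rewrite -rmorphN nrZ nri normrN.
have [Dw Aw] := sa_closed (fun n => proj1 (hu n)) uw Auw.
by exists w; split=> //; rewrite Aw subrK.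
Qed.

Section Resolvent.
Variables (s : R) (s1 : s ^+ 2 = 1).
Local Notation Rs := (resolvent D A s).

Lemma resolventP x : D (Rs x) /\ A (Rs x) + s%:C *: ('i *: Rs x) = x.
Proof.
rewrite /resolvent; case: xgetP => [u _ //|h].
by have [u /h] := range_shift_i x s1.
Qed.

Lemma resolvent_dom x : D (Rs x). Proof. by case: (resolventP x). Qed.

Lemma op_resolvent x : A (Rs x) = x - s%:C *: ('i *: Rs x).
Proof. by rewrite -[X in _ = X - _](proj2 (resolventP x)) addrK. Qed.

Lemma resolventE u x : D u -> A u + s%:C *: ('i *: u) = x -> Rs x = u.
Proof.
move=> Du Au; have [DR RE] := resolventP x.
apply/eqP; rewrite -subr_eq0; apply/eqP/nr_eq0/eqP; rewrite -sqrf_eq0.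
have DB := saB DR Du; have := nr_shift_i s DB.
have -> : A (Rs x - u) + s%:C *: ('i *: (Rs x - u)) = 0.
  by rewrite sa_opB // !scalerBr addrACA -opprD RE Au subrr.
rewrite nr0 s1 mul1r expr0n /= => e.
have := sqr_ge0 (nr (A (Rs x - u))); have := sqr_ge0 (nr (Rs x - u)).
by move=> h1 h2; apply/eqP; lra.
Qed.

Lemma resolvent_clin : clinear Rs.
Proof.
move=> a x y; apply: resolventE.
  by apply: (saP sa); exact: resolvent_dom.
rewrite (saL sa); try exact: resolvent_dom.
rewrite !scale_clin addrACA -scalerDr.
by rewrite !(proj2 (resolventP _)).
Qed.

Lemma resolvent_nr x : nr (Rs x) <= nr x.
Proof.
rewrite -(@ler_pXn2r _ 2) ?nnegrE ?nr_ge0 // -[in leRHS](proj2 (resolventP x)).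
rewrite nr_shift_i; last exact: resolvent_dom.
by rewrite s1 mul1r lerDr exprn_ge0 ?nr_ge0.
Qed.

Lemma resolvent_op x : D x -> Rs (A x) = x - s%:C *: ('i *: Rs x).
Proof.
move=> Dx; have -> : A x = (A x + s%:C *: ('i *: x)) - s%:C *: ('i *: x) by rewrite addrK.
rewrite (clinB _ _ resolvent_clin) !(clinZ _ _ resolvent_clin); congr (_ - _).
exact: resolventE.
Qed.

Lemma resolvent_commutes : commutes D A Rs.
Proof.
move=> x Dx; split; first exact: resolvent_dom.
by rewrite op_resolvent resolvent_op.
Qed.

Lemma commutes_resolvent Q : clinear Q -> commutes D A Q ->
  forall x, Q (Rs x) = Rs (Q x).
Proof.
move=> Ql QA x; have [DR RE] := resolventP x; have [DQ AQ] := QA _ DR.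
apply/esym/resolventE => //.
by rewrite AQ -!(clinZ _ _ Ql) -(clinD _ _ Ql) RE.
Qed.

Lemma resolvent_commutesE Q : clinear Q -> (forall x, Q (Rs x) = Rs (Q x)) ->
  commutes D A Q.
Proof.
move=> Ql QR x Dx; have xR : Rs (A x + s%:C *: ('i *: x)) = x by exact: resolventE.
have QxE : Q x = Rs (Q (A x + s%:C *: ('i *: x))) by rewrite -QR xR.
split; first by rewrite QxE; exact: resolvent_dom.
rewrite {1}QxE op_resolvent -QxE (clinD _ _ Ql) !(clinZ _ _ Ql) addrK //.
Qed.

End Resolvent.

Lemma resolvent_adj s x y : s ^+ 2 = 1 ->
  dot (resolvent D A s x) y = dot x (resolvent D A (- s) y).
Proof.
move=> s1; have s1' : (- s) ^+ 2 = 1 by rewrite sqrrN.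
have [Dv hv] := resolventP s1' y; have [Du hu] := resolventP s1 x.
rewrite -[in LHS]hv -[in RHS]hu !dotE (sa_sym sa) // dotir_il; ring.
Qed.

(** The operator S = ((A + i)^-1 + (A - i)^-1) / 2 = A (A^2 + 1)^-1 is bounded
    and has the sign of A: A = S + A S A, so that on the domain <x, A x> is the
    sum of <x, S x> and <A x, S (A x)>. Its sign projection commutes with the
    resolvents, hence with A, and therefore splits A as well. *)
Lemma spectral_split : exists E, [/\ isproj E, commutes D A E,
  forall x, D x -> E x = x -> dot x (A x) <= 0,
  forall x, D x -> E x = 0 -> 0 <= dot x (A x) &
  (forall x, D x -> A x = 0 -> E x = x) /\
  (forall Q, isproj Q -> commutes D A Q -> forall x, Q (E x) = E (Q x))].
Proof.
have p1 : (1 : R) ^+ 2 = 1 by rewrite expr1n.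
have m1 : (- 1 : R) ^+ 2 = 1 by rewrite sqrrN.
set Rp := resolvent D A 1; set Rm := resolvent D A (-1).
have Rpl : clinear Rp := resolvent_clin p1.
have Rml : clinear Rm := resolvent_clin m1.
pose S x := (2^-1)%:C *: (Rp x + Rm x).
have Sl : clinear S.
  by move=> a x y; rewrite /S Rpl Rml addrACA -scalerDr scale_clin.
have Rpm x y : dot (Rp x) y = dot x (Rm y) by exact: resolvent_adj.
have Rmp x y : dot (Rm x) y = dot x (Rp y) by rewrite dotC -Rpm dotC.
have Ss : dsymmetric S.
  by move=> x y; rewrite /S !dotE Rpm Rmp; ring.
have S1 x : nr (S x) <= nr x.
  rewrite /S nrZ ger0_norm //; have := nrD (Rp x) (Rm x).
  have := resolvent_nr p1 x; have := resolvent_nr m1 x; rewrite -/Rp -/Rm; lra.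
have [E [Ep EneS EposS EkerS EQ]] := sign_projection Sl Ss S1.
have commS Q : clinear Q -> commutes D A Q -> forall x, Q (S x) = S (Q x).
  move=> Ql QA x; rewrite /S (clinZ _ _ Ql) (clinD _ _ Ql).
  by rewrite !(commutes_resolvent _ Ql QA).
have EA : commutes D A E.
  apply: (resolvent_commutesE p1 (proj_clin Ep)) => x; apply/esym.
  by apply: (EQ _ Rm) => //; apply: commS => //; exact: resolvent_commutes.
have key x : D x -> dot x (A x) = dot x (S x) + dot (A x) (S (A x)).
  move=> Dx; rewrite /S.
  have -> : Rp (A x) = _ := resolvent_op p1 Dx.
  have -> : Rm (A x) = _ := resolvent_op m1 Dx; rewrite -/Rp -/Rm.
  have ARp : A (Rp x) = _ := op_resolvent p1 x.
  have ARm : A (Rm x) = _ := op_resolvent m1 x.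
  have Dp : D (Rp x) by exact: resolvent_dom.
  have Dm : D (Rm x) by exact: resolvent_dom.
  have e y : D y -> dot (A x) ('i *: y) = dot x ('i *: A y).
    by move=> Dy; rewrite (sa_sym sa) ?sa_opZ //; exact: saZ.
  rewrite !dotE !e // ARp ARm.
  have f y z c : dot x ('i *: (y - c%:C *: ('i *: z))) = dot x ('i *: y) + c * dot x z.
    by rewrite scalerBr dotBr scalerA mulrC -scalerA scaler_ii scalerN dotNr opprK dotZr.
  rewrite !f (dotC (A x)); lra.
exists E; split=> // [x Dx Ex|x Dx Ex|].
- have [_ AE] := EA _ Dx; rewrite key //.
  have h1 := EneS _ Ex; have h2 := EneS (A x); rewrite -AE Ex in h2.
  have := h2 erefl; lra.
- have [_ AE] := EA _ Dx; rewrite key // addr_ge0 ?EposS //.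
  by rewrite -AE Ex sa_op0.
split=> [x Dx Ax|Q Qp QA x].
  apply: EkerS; rewrite /S.
  have -> : Rp x = - ('i *: x).
    apply: (resolventE p1); first by rewrite -scaleNr; exact: saZ.
    by rewrite -scaleNr sa_opZ // Ax scaler0 add0r scale1r scaleNr scalerN scaler_ii opprK.
  have -> : Rm x = 'i *: x.
    apply: (resolventE m1); first exact: saZ.
    by rewrite sa_opZ // Ax scaler0 add0r scaler_ii rmorphN /= scaleN1r opprK.
  by rewrite addNr scaler0.
have Ql := proj_clin Qp.
by apply: (EQ _ Q) => //; [exact: proj_sym|exact: commS|exact: commS].
Qed.

End Theory.
End SelfAdjoint.

(** * The spectral family *)

Section SpectralFamily.
Context {R : realType} {H : hilbertType R}.
Implicit Types (x y z w : H) (r s l m : R) (D : set H) (A S T E Q : H -> H).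

Section ResolutionIntervals.
Variables (E : R -> H -> H) (Ep : forall l, isproj (E l)).
Hypothesis Emono : forall l m x, l <= m -> E l (E m x) = E l x.

(** The spectral projection of the interval ]l, m]. *)
Definition Eitv l m x := E m x - E l x.

Lemma mono_proj_comm l m x : l <= m -> E m (E l x) = E l x.
Proof.
move=> lm; apply: dot_inj => w; rewrite -(proj_sym (Ep m)) -!(proj_sym (Ep l)).
by rewrite Emono.
Qed.

Lemma Eitv_proj l m : l <= m -> isproj (Eitv l m).
Proof.
move=> lm; rewrite /Eitv; split=> [a x y|x|x y].
- by rewrite (proj_clin (Ep m)) (proj_clin (Ep l)) scalerBr opprD addrACA.
- rewrite (projB (Ep m)) (projB (Ep l)) !(proj_idem (Ep _)) mono_proj_comm //.
  by rewrite Emono // subrr subr0.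
- by rewrite !dotE (proj_sym (Ep m)) (proj_sym (Ep l)).
Qed.

Lemma Eitv_sqr l m x : l <= m -> nr (Eitv l m x) ^+ 2 = nr (E m x) ^+ 2 - nr (E l x) ^+ 2.
Proof.
move=> lm; rewrite -(proj_dot (Eitv_proj lm)) /Eitv dotBr.
by rewrite (proj_dot (Ep m)) (proj_dot (Ep l)).
Qed.

Lemma mono_proj_nd l m x : l <= m -> nr (E l x) ^+ 2 <= nr (E m x) ^+ 2.
Proof. by move=> lm; rewrite -subr_ge0 -Eitv_sqr // sqr_ge0. Qed.

Lemma Eitv_fix l m v : l <= m -> Eitv l m v = v -> E m v = v /\ E l v = 0.
Proof.
move=> lm <-; rewrite /Eitv (projB (Ep m)) (projB (Ep l)) !(proj_idem (Ep _)).
by rewrite mono_proj_comm // Emono // subrr.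
Qed.

Lemma Eitv_add l m k x : Eitv l k x = Eitv l m x + Eitv m k x.
Proof. by rewrite /Eitv [RHS]addrC addrA subrK. Qed.

Lemma Eitv_symitv_cvg x :
  cvgs (fun n => x - E n.+1%:R x) 0 -> cvgs (fun n => E (- n.+1%:R) x) 0 ->
  cvgs (fun n => Eitv (- n.+1%:R) n.+1%:R x) x.
Proof.
move=> hp hn e e0; have e20 : 0 < e / 2 by lra.
have [N hN] := hp _ e20; have [M hM] := hn _ e20.
exists (maxn N M) => n; rewrite geq_max => /andP[/hN + /hM].
rewrite !subr0 /Eitv => h1 h2.
have -> : E n.+1%:R x - E (- n.+1%:R) x - x = - ((x - E n.+1%:R x) + E (- n.+1%:R) x).
  by rewrite opprD opprB addrAC.
by rewrite nrN; have := nrD (x - E n.+1%:R x) (E (- n.+1%:R) x); lra.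
Qed.

End ResolutionIntervals.

(** E l is the spectral projection of ]-oo, l]. *)
Record spectral_family D A (E : R -> H -> H) : Prop := SpectralFamily {
  sf_proj : forall l, isproj (E l);
  sf_comm : forall l, commutes D A (E l);
  sf_le : forall l x, D x -> E l x = x -> dot x (A x) <= l * nr x ^+ 2;
  sf_ge : forall l x, D x -> E l x = 0 -> l * nr x ^+ 2 <= dot x (A x);
  sf_ker : forall l x, D x -> A x = l%:C *: x -> E l x = x;
  sf_commE : forall l m x, E l (E m x) = E m (E l x)
}.

Lemma commutes_shift D A Q r : clinear Q -> commutes D A Q -> commutes D (opshift A r) Q.
Proof.
move=> Ql QA x Dx; have [DQ AQ] := QA x Dx; split=> //.
by rewrite /opshift AQ (clinB _ _ Ql) (clinZ _ _ Ql).
Qed.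

Lemma shift_commutes D A Q r : clinear Q -> commutes D (opshift A r) Q -> commutes D A Q.
Proof.
move=> Ql QA x Dx; have [DQ e] := QA x Dx; split=> //.
move: e; rewrite /opshift (clinB _ _ Ql) (clinZ _ _ Ql).
by move/(congr1 (+%R^~ (r%:C *: Q x))); rewrite /= !subrK.
Qed.

Lemma spectral_family_exists D A : selfadj D A ->
  exists E : R -> H -> H, spectral_family D A E.
Proof.
move=> sa; have /choice [E hE] l := spectral_split (sa_shift sa l).
have Ep l : isproj (E l) by case: (hE l).
have Ec l : commutes D A (E l).
  by case: (hE l) => _ h _ _ _; apply: shift_commutes h; exact: proj_clin.
exists E; split=> // [l x Dx Ex|l x Dx Ex|l x Dx Ax|l m x].
- case: (hE l) => _ _ h _ _; have := h x Dx Ex.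
  by rewrite /opshift !dotE dotxx subr_le0.
- case: (hE l) => _ _ _ h _; have := h x Dx Ex.
  by rewrite /opshift !dotE dotxx subr_ge0.
- case: (hE l) => _ _ _ _ [h _]; apply: h => //.
  by rewrite /opshift Ax subrr.
- case: (hE m) => _ _ _ _ [_ h]; apply: h => //.
  by apply: commutes_shift => //; exact: proj_clin.
Qed.

(** The operators Q n do not amplify the error made by replacing x by an element
    of the dense subspace D. *)
Lemma cvgs0_dense D A (Q : nat -> H -> H) : selfadj D A ->
  (forall n x y, Q n (x + y) = Q n x + Q n y) -> (forall n x, nr (Q n x) <= nr x) ->
  (forall x, D x -> cvgs (fun n => Q n x) 0) -> forall x, cvgs (fun n => Q n x) 0.
Proof.
move=> sa QD Q1 QC x e e0; have [u Du ux] := sa_dense sa x.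
have e20 : 0 < e / 2 by lra.
have [M hM] := ux _ e20; have [N hN] := QC _ (Du M) _ e20.
exists N => n Nn; rewrite subr0 -(subrK (u M) x) QD.
have := hN n Nn; have := hM _ (leqnn M); rewrite subr0 nr_distC.
have := nrD (Q n (x - u M)) (Q n (u M)); have := Q1 n (x - u M); lra.
Qed.

(** A form of the Cauchy-Schwarz inequality: positivity at v - P u shows that
    2 <u, T v> <= d (|u|^2 + |v|^2) for u in the domain, hence for all u by
    density, and then u may be taken proportional to T v. *)
Lemma form_bound D T P (d : R) : selfadj D T -> isproj P -> commutes D T P -> 0 < d ->
  (forall u, D u -> P u = u -> 0 <= dot u (T u) <= d * nr u ^+ 2) ->
  forall v, D v -> P v = v -> nr (T v) <= d * nr v.
Proof.
move=> sa Pp PT d0 h v Dv Pv.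
have [_ PTv] := PT v Dv; rewrite Pv in PTv.
have h1 u : D u -> 2 * dot u (T v) <= d * (nr u ^+ 2 + nr v ^+ 2).
  move=> Du; have [DPu _] := PT u Du.
  have Puv : P (v - P u) = v - P u by rewrite (projB Pp) (proj_idem Pp) Pv.
  have /andP[q1 _] := h _ (saB sa Dv DPu) Puv.
  have /andP[_ q2] := h _ DPu (proj_idem Pp u).
  have /andP[_ q3] := h _ Dv Pv.
  rewrite (sa_opB sa) // !dotE in q1.
  have e1 : dot v (T (P u)) = dot (P u) (T v) by rewrite -(sa_sym sa) // dotC.
  have e2 : dot (P u) (T v) = dot u (T v) by rewrite (proj_sym Pp) -PTv.
  have q4 : nr (P u) ^+ 2 <= nr u ^+ 2 by rewrite ler_pXn2r ?nnegrE ?nr_ge0 ?proj_nr.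
  have := ler_wpM2l (ltW d0) q4; rewrite e1 e2 in q1; lra.
have h2 w : 2 * dot (T v) w <= d * (nr w ^+ 2 + nr v ^+ 2).
  have [u Du uw] := sa_dense sa w.
  pose f n : R := d * (nr (u n) ^+ 2 + nr v ^+ 2) - 2 * dot (T v) (u n).
  have fl : f @ \oo --> d * (nr w ^+ 2 + nr v ^+ 2) - 2 * dot (T v) w.
    apply: cvgB; apply: cvgMr; last exact: cvgs_dot.
    by apply: cvgD; [apply: cvgM; exact: cvgs_nr|exact: cvg_cst].
  rewrite -subr_ge0 -(cvg_lim _ fl) //; apply: limr_ge; first by apply: cvgP fl.
  by near=> n; rewrite subr_ge0 dotC; exact: h1.
rewrite -(@ler_pXn2r _ 2) ?nnegrE ?mulr_ge0 ?nr_ge0 ?(ltW d0) //.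
(* at w = T v / d the inequality h2 reads |T v|^2 <= d^2 |v|^2 *)
have := h2 ((d^-1)%:C *: T v); rewrite dotZr dotxx nrZ ger0_norm ?invr_ge0 ?(ltW d0) //.
rewrite !exprMn; move: (nr (T v) ^+ 2) (nr v ^+ 2) => p q hpq.
have d2 : 0 <= d by lra.
have := ler_wpM2l d2 hpq.
have -> : d * (2 * (d^-1 * p)) = 2 * p by field; lra.
have -> : d * (d * (d^-1 ^+ 2 * p + q)) = p + d ^+ 2 * q by field; lra.
lra.
Unshelve. all: by end_near. Qed.

Section Theory.
Variables (D : set H) (A : H -> H) (sa : selfadj D A).
Variables (E : R -> H -> H) (sf : spectral_family D A E).

Let Ep l : isproj (E l) := sf_proj sf l.

(** For l < m, a vector v of the domain that is fixed by E l and killed by E m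
    satisfies m |v|^2 <= <v, A v> <= l |v|^2, so v = 0. *)
Lemma sf_mono l m x : l <= m -> E l (E m x) = E l x.
Proof.
rewrite le_eqVlt => /orP[/eqP ->|lm]; first exact: proj_idem.
apply/eqP; rewrite eq_sym -subr_eq0 -(projB (Ep l)); apply/eqP.
have hD y : D y -> E l (y - E m y) = 0.
  move=> Dy; set v := E l _.
  have Dv : D v by apply: (proj1 (sf_comm sf l _)); apply: (saB sa Dy); case: (sf_comm sf m Dy).
  have v1 : E l v = v by exact: proj_idem.
  have v0 : E m v = 0.
    by rewrite /v -(sf_commE sf) (projB (Ep m)) (proj_idem (Ep m)) subrr proj0.
  apply: nr_eq0; apply/eqP; rewrite -sqrf_eq0.
  have := sf_le sf Dv v1; have := sf_ge sf Dv v0.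
  have := sqr_ge0 (nr v); move: (nr v ^+ 2) (dot v _) => p q p0 h1 h2.
  have h3 : (m - l) * p <= 0 by rewrite mulrBl; lra.
  by rewrite eq_le p0 andbT -(pmulr_rle0 _ (_ : 0 < m - l)) // subr_gt0.
have [u Du ux] := sa_dense sa x.
have ul := proj_cvgs (Ep l) (proj_cvgs (proj_compl (Ep m)) ux).
apply: (cvgs_unique ul) => e e0; exists 0%N => n _ /=.
by rewrite hD // subrr nr0.
Qed.

Let mono : forall l m x, l <= m -> E l (E m x) = E l x := sf_mono.
Let Eitvp l m (lm : l <= m) : isproj (Eitv E l m) := Eitv_proj Ep mono lm.

Lemma Eitv_comm l m : commutes D A (Eitv E l m).
Proof.
move=> x Dx; have [D1 A1] := sf_comm sf l Dx; have [D2 A2] := sf_comm sf m Dx.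
by split; [exact: (saB sa)|rewrite /Eitv (sa_opB sa) // A1 A2].
Qed.

Lemma Eitv_bound_dom l m v : l <= m -> D v -> Eitv E l m v = v ->
  nr (A v - l%:C *: v) <= (m - l) * nr v.
Proof.
rewrite le_eqVlt => /orP[/eqP ->|lm] Dv Pv.
  have -> : v = 0 by rewrite -Pv /Eitv subrr.
  by rewrite (sa_op0 sa) scaler0 subrr nr0 mulr0.
apply: (form_bound (sa_shift sa l) (Eitvp (ltW lm)) _ _ _ Dv Pv).
- by apply: commutes_shift; [exact: proj_clin (Eitvp (ltW lm))|exact: Eitv_comm].
- by rewrite subr_gt0.
move=> u Du Pu; have [u1 u0] := Eitv_fix Ep mono (ltW lm) Pu.
have := sf_le sf Du u1; have := sf_ge sf Du u0; rewrite /opshift !dotE dotxx.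
by move=> h1 h2; apply/andP; split; lra.
Qed.

(** A is bounded on the part of its domain in the range of a spectral projection
    of an interval, so the maximality of the domain gives the whole range. *)
Lemma Eitv_dom l m x : l <= m -> D (Eitv E l m x).
Proof.
move=> lm; have Pp := Eitvp lm; set P := Eitv E l m in Pp *.
apply: (sa_max (sa_shift sa l) (M := nr (P x) * (m - l))) => y Dy.
have PT := commutes_shift l (proj_clin Pp) (@Eitv_comm l m).
have [DPy PTy] := PT y Dy; rewrite -[X in dot X _](proj_idem Pp) (proj_sym Pp) -PTy.
apply: (le_trans (ler_dotW _ _)); rewrite -mulrA ler_wpM2l ?nr_ge0 //.
apply: (le_trans (Eitv_bound_dom lm DPy (proj_idem Pp y))).
by rewrite ler_wpM2l ?subr_ge0 // proj_nr.
Qed.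

(** The range of the spectral projection of a short interval consists of
    approximate eigenvectors; all approximations of A rest on this estimate. *)
Lemma Eitv_bound l m x : l <= m ->
  nr (A (Eitv E l m x) - l%:C *: Eitv E l m x) <= (m - l) * nr (Eitv E l m x).
Proof.
move=> lm; apply: Eitv_bound_dom => //; first exact: Eitv_dom.
exact: (proj_idem (Eitvp lm)).
Qed.

(** The vectors E ]l, l + 1/n] x are Cauchy because their norms decrease. By
    Eitv_bound their limit w satisfies A w = l w, so E l fixes w; but E l kills
    each of the vectors, hence w, and w = 0. *)
Lemma sf_right_cvg l x : cvgs (fun n => Eitv E l (l + n.+1%:R^-1) x) 0.
Proof.
have ln n : l <= l + n.+1%:R^-1 by rewrite lerDl ltW // invn_pos.
move: x; apply: (cvgs0_dense sa) => [n x y|n x|x Dx].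
- exact: (projD (Eitvp (ln n))).
- exact: (proj_nr (Eitvp (ln n))).
pose v n := Eitv E l (l + n.+1%:R^-1) x; rewrite -/v.
have dec n k : (n <= k)%N -> l + k.+1%:R^-1 <= l + n.+1%:R^-1.
  by move=> nk; rewrite lerD2l lef_pV2 ?posrE // ler_nat.
pose f n := nr (E (l + n.+1%:R^-1) x) ^+ 2.
have fni : {homo f : n k / (n <= k)%N >-> k <= n}.
  by move=> n k nk; apply: (mono_proj_nd Ep mono); exact: dec.
have [w vw] : exists w, cvgs v w.
  apply: cauchy_cvgs => e e0.
  have : cvg (f @ \oo).
    apply: nonincreasing_is_cvgn => //; exists 0 => _ [n _ <-]; exact: sqr_ge0.
  move=> /cvg_ex [c /cvgrPdist_lt hc].
  have e20 : 0 < e ^+ 2 / 2 by rewrite divr_gt0 ?exprn_gt0.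
  have [N _ hN] := hc _ e20; exists N => n Nn; apply: nr_sqr_lt => //.
  have -> : v n - v N = - Eitv E (l + n.+1%:R^-1) (l + N.+1%:R^-1) x.
    by rewrite /v /Eitv !opprB addrA subrK.
  rewrite nrN (Eitv_sqr Ep mono) ?dec // -/(f n) -/(f N).
  have := hN n Nn; have := hN N (leqnn N); rewrite /= !ltr_norml.
  by move: (f n) (f N) => p q; lra.
suff -> : 0 = w by [].
have El0 : E l w = 0.
  apply: (cvgs_unique (proj_cvgs (Ep l) vw)) => e e0; exists 0%N => n _ /=.
  have [_ ->] := Eitv_fix Ep mono (ln n) (proj_idem (Eitvp (ln n)) x).
  by rewrite subrr nr0.
have [Dw Tw] : D w /\ opshift A l w = 0.
  apply: (sa_closed (sa_shift sa l) (u := v)) vw _ => [n|e e0]; first exact: Eitv_dom.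
  have e'0 : 0 < e / (nr x + 1) by rewrite divr_gt0 // ltr_wpDl // nr_ge0.
  have [N hN] := invn_small e'0; exists N => n Nn /=.
  rewrite subr0 (le_lt_trans (Eitv_bound x (ln n))) //.
  have h1 := proj_nr (Eitvp (ln n)) x; have := hN n Nn.
  rewrite ltr_pdivlMr ?ltr_wpDl ?nr_ge0 //; apply: le_lt_trans.
  rewrite addrC addKr ler_wpM2l // ?(ltW (invn_pos _)) //; lra.
rewrite -El0; apply: (sf_ker sf) => //.
by move/eqP: Tw; rewrite subr_eq0 => /eqP.
Qed.

(** For x in the domain and v = x - E l x, l |v|^2 <= <v, A v> gives
    l |v| <= |A x|. *)
Lemma sf_cvg_pinfty x : cvgs (fun n => x - E n.+1%:R x) 0.
Proof.
move: x; apply: (cvgs0_dense sa) => [n x y|n x|x Dx].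
- exact: (projD (proj_compl (Ep _))).
- exact: (proj_nr (proj_compl (Ep _))).
move=> e e0; have e'0 : 0 < e / (nr (A x) + 1) by rewrite divr_gt0 // ltr_wpDl // nr_ge0.
have [N hN] := invn_small e'0; exists N => n Nn; rewrite subr0.
have := hN n Nn; rewrite ltr_pdivlMr ?ltr_wpDl ?nr_ge0 // => he; apply: le_lt_trans he.
rewrite mulrC ler_pdivlMr //.
have [DE AE] := sf_comm sf n.+1%:R Dx.
have Dv := saB sa Dx DE; set v := x - _ in Dv *.
have v0 : E n.+1%:R v = 0 by rewrite (projB (Ep _)) (proj_idem (Ep _)) subrr.
have := sf_ge sf Dv v0; have := ler_dotW v (A v).
have : nr (A v) <= nr (A x).
  by rewrite (sa_opB sa) // AE; apply: (proj_nr (proj_compl (Ep _))).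
have [v00|vn0] := eqVneq (nr v) 0; first by rewrite v00 mul0r => *; have := nr_ge0 (A x); lra.
have vp : 0 < nr v by rewrite lt_neqAle eq_sym vn0 nr_ge0.
move=> h1 h2 h3; rewrite -(ler_pM2l vp).
have := ler_wpM2l (ltW vp) h1; move: h3; rewrite expr2; lra.
Qed.

Lemma sf_cvg_ninfty x : cvgs (fun n => E (- n.+1%:R) x) 0.
Proof.
move: x; apply: (cvgs0_dense sa) => [n x y|n x|x Dx].
- exact: (projD (Ep _)).
- exact: (proj_nr (Ep _)).
move=> e e0; have e'0 : 0 < e / (nr (A x) + 1) by rewrite divr_gt0 // ltr_wpDl // nr_ge0.
have [N hN] := invn_small e'0; exists N => n Nn; rewrite subr0.
have := hN n Nn; rewrite ltr_pdivlMr ?ltr_wpDl ?nr_ge0 // => he; apply: le_lt_trans he.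
rewrite mulrC ler_pdivlMr //.
have [Dv AE] := sf_comm sf (- n.+1%:R) Dx; set v := E _ x in Dv AE *.
have v0 : E (- n.+1%:R) v = v by exact: (proj_idem (Ep _)).
have := sf_le sf Dv v0; have := ler_dot v (A v); rewrite ler_norml => /andP[+ _].
have : nr (A v) <= nr (A x) by rewrite AE; apply: (proj_nr (Ep _)).
have [v00|vn0] := eqVneq (nr v) 0; first by rewrite v00 mul0r => *; have := nr_ge0 (A x); lra.
have vp : 0 < nr v by rewrite lt_neqAle eq_sym vn0 nr_ge0.
move=> h1 h2 h3; rewrite -(ler_pM2l vp).
have := ler_wpM2l (ltW vp) h1; move: h3; rewrite expr2 mulNr; lra.
Qed.

End Theory.
End SpectralFamily.

(** * Sums of orthogonal projections *)

Section ProjectionSums.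
Context {R : realType} {H : hilbertType R}.
Implicit Types (x y z w : H) (r s l m : R) (E P Q : H -> H).

Lemma proj_add P Q : isproj P -> isproj Q -> (forall x, P (Q x) = 0) ->
  isproj (fun x => P x + Q x).
Proof.
move=> Pp Qp PQ; have QP x : Q (P x) = 0.
  by apply: dot_inj => w; rewrite -(proj_sym Qp) -(proj_sym Pp) PQ dot0l dot0r.
split=> [a x y|x|x y].
- by rewrite (proj_clin Pp) (proj_clin Qp) scalerDr addrACA.
- by rewrite (projD Pp) (projD Qp) PQ QP !(proj_idem _) // addr0 add0r.
- by rewrite !dotE (proj_sym Pp) (proj_sym Qp).
Qed.

Section Sum.
Variables (Q : nat -> H -> H) (Qp : forall n, isproj (Q n)).
Hypothesis Qorth : forall i j x, i != j -> Q i (Q j x) = 0.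

Let S n x := \sum_(0 <= k < n) Q k x.

Let SE n x : S n.+1 x = S n x + Q n x. Proof. by rewrite /S big_nat_recr. Qed.

Let QS n k x : (n <= k)%N -> Q k (S n x) = 0.
Proof.
elim: n => [|n IH] nk; first by rewrite /S big_geq // proj0.
by rewrite SE (projD (Qp k)) IH ?(ltnW nk) // Qorth ?addr0 // gtn_eqF.
Qed.

Lemma proj_sum_proj n : isproj (S n).
Proof.
elim: n => [|n IH].
  have -> : S 0 = fun=> 0 by apply/funext => x; rewrite /S big_geq.
  by split=> [a x y|x|x y] //; rewrite ?scaler0 ?addr0 // dot0l dot0r.
have -> : S n.+1 = fun x => Q n x + S n x by apply/funext => x; rewrite SE addrC.
by apply: proj_add => // x; exact: QS.
Qed.

Let SQ n k x : (n <= k)%N -> S n (Q k x) = 0.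
Proof.
move=> nk; apply: dot_inj => w.
by rewrite -(proj_sym (proj_sum_proj n)) -(proj_sym (Qp k)) QS // dot0l dot0r.
Qed.

Let SS n k x : (n <= k)%N -> S n (S k x) = S n x.
Proof.
move=> nk; rewrite -(subnKC nk); elim: (k - n)%N => [|d IH].
  by rewrite addn0 (proj_idem (proj_sum_proj n)).
by rewrite addnS SE (projD (proj_sum_proj n)) IH SQ ?addr0 // leq_addr.
Qed.

Lemma proj_sum_sqr n x : nr (S n x) ^+ 2 = \sum_(0 <= k < n) nr (Q k x) ^+ 2.
Proof.
rewrite -(proj_dot (proj_sum_proj n)) /S.
elim: n => [|n IH]; first by rewrite !big_geq // dot0r.
by rewrite !big_nat_recr //= dotDr IH (proj_dot (Qp n)).
Qed.

(** Partial sums are projections of increasing squared norms, bounded by |x|^2;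
    their differences have the differences of these numbers as squared norms. *)
Lemma proj_sum_exists : exists P, isproj P /\ forall x, cvgs (fun n => S n x) (P x).
Proof.
have Sdist n k x : (n <= k)%N ->
    nr (S k x - S n x) ^+ 2 = nr (S k x) ^+ 2 - nr (S n x) ^+ 2.
  move=> nk; rewrite nrB_sqr (proj_sym (proj_sum_proj k)).
  have -> : S k (S n x) = S n x.
    apply: dot_inj => w; rewrite -(proj_sym (proj_sum_proj k)).
    by rewrite -!(proj_sym (proj_sum_proj n)) SS.
  by rewrite (proj_dot (proj_sum_proj n)); ring.
have /choice [P SP] x : exists z, cvgs (fun n => S n x) z.
  pose g n := nr (S n x) ^+ 2.
  have gnd : {homo g : n k / (n <= k)%N >-> n <= k}.
    by move=> n k nk; rewrite -subr_ge0 -Sdist // sqr_ge0.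
  have : cvg (g @ \oo).
    apply: nondecreasing_is_cvgn => //; exists (nr x ^+ 2) => _ [n _ <-].
    by rewrite /g ler_pXn2r ?nnegrE ?nr_ge0 // (proj_nr (proj_sum_proj n)).
  move=> /cvg_ex [c /cvgrPdist_lt hc]; apply: cauchy_cvgs => e e0.
  have e20 : 0 < e ^+ 2 / 2 by rewrite divr_gt0 ?exprn_gt0.
  have [N _ hN] := hc _ e20; exists N => n Nn; apply: nr_sqr_lt => //.
  rewrite Sdist // -/(g n) -/(g N).
  have := hN n Nn; have := hN N (leqnn N); rewrite /= !ltr_norml.
  by move: (g n) (g N) => p q; lra.
have SnP n x : S n (P x) = S n x.
  apply: cvgs_unique (proj_cvgs (proj_sum_proj n) (SP x)) _ => e e0.
  by exists n => k nk /=; rewrite SS // subrr nr0.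
exists P; split=> //; split=> [a x y|x|x y].
- by apply: clinear_lim SP a x y => n; exact: proj_clin (proj_sum_proj n).
- apply: cvgs_unique (SP (P x)) _.
  by rewrite (_ : (fun n => _) = (fun n => S n x)) //; apply/funext => n.
- rewrite dotC; apply: cvgs_dot_eq (SP x) (SP y) _ => n.
  by rewrite dotC (proj_sym (proj_sum_proj n)).
Qed.

End Sum.
End ProjectionSums.

(** * From the spectral family to a projection-valued measure *)

Section SymmetricIntervals.
Context {R : realType}.

Definition symitv n : set (measurableTypeR R) := `]- n.+1%:R, n.+1%:R]%classic.

Lemma symitv_le n : - n.+1%:R <= n.+1%:R :> R.
Proof. by rewrite (@le_trans _ _ 0) // oppr_le0. Qed.

Lemma bigcup_symitv : \bigcup_n symitv n = setT.
Proof.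
apply/seteqP; split=> // t _; exists (Num.truncn `|t|) => //.
rewrite /symitv /= in_itv /=; have := truncnS_gt `|t|; rewrite ltr_norml => /andP[-> h].
exact: ltW.
Qed.

Lemma symitv_nd n k : (n <= k)%N -> symitv n `<=` symitv k.
Proof. by move=> nk; apply: subset_itv; rewrite leBSide /= ?lerN2 ler_nat ltnS. Qed.

End SymmetricIntervals.

Section Stieltjes.
Context {R : realType}.

Lemma stieltjes_measure_exists (F : R -> R) : nondecreasing F ->
  (forall l e, 0 < e -> exists2 d : R, 0 < d & F (l + d) < F l + e) ->
  exists mu : {measure set (measurableTypeR R) -> \bar R},
    forall a b, a <= b -> mu `]a, b]%classic = (F b - F a)%:E.
Proof.
move=> Fnd Frc.
have Fr : right_continuous F.
  move=> l; apply/cvgrPdist_lt => e e0; have [d d0 hd] := Frc l e e0.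
  near=> t; rewrite distrC ger0_norm ?subr_ge0; last by apply: Fnd.
  rewrite ltrBlDl; apply: le_lt_trans hd; apply: Fnd.
  by near: t; apply: nbhs_right_le; rewrite ltrDl.
pose G : cumulative R R := HB.pack F (isCumulative.Build R _ R F Fnd Fr).
exists (lebesgue_stieltjes_measure G : {measure set (measurableTypeR R) -> \bar R}) => a b ab.
rewrite /= /lebesgue_stieltjes_measure /measure_extension measurable_mu_extE /=.
  by rewrite wlength_itv_bnd.
exact: is_ocitv.
Unshelve. all: by end_near. Qed.

End Stieltjes.

Section ResolutionOfIdentity.
Context {R : realType} {H : hilbertType R}.
Implicit Types (x y z w : H) (r s l m : R) (P Q : H -> H).

Lemma bounded_operator_exists P : isproj P ->
  exists T : bounded_operator H, forall x, T x = P x.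
Proof.
move=> Pp.
pose L : {linear H -> H} := HB.pack P
  (GRing.isLinear.Build R[i] H H *:%R P (proj_clin Pp)).
have Lb : exists M : R, forall x, `|L x| <= M%:C * `|x|.
  by exists 1 => x; rewrite mul1r !normE lecR; exact: proj_nr.
by exists (BoundedOperator Lb).
Qed.

Variable E : R -> H -> H.
Hypothesis Ep : forall l, isproj (E l).
Hypothesis Emono : forall l m x, l <= m -> E l (E m x) = E l x.
Hypothesis Eright : forall l x, cvgs (fun n => E (l + n.+1%:R^-1) x - E l x) 0.
Hypothesis Epinfty : forall x, cvgs (fun n => x - E n.+1%:R x) 0.
Hypothesis Eninfty : forall x, cvgs (fun n => E (- n.+1%:R) x) 0.

Let Eitvp l m (lm : l <= m) : isproj (Eitv E l m) := Eitv_proj Ep Emono lm.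

Lemma spectral_measure_exists x : exists mu : {measure set (measurableTypeR R) -> \bar R},
  forall a b, a <= b -> mu `]a, b]%classic = (nr (Eitv E a b x) ^+ 2)%:E.
Proof.
have [||mu hmu] := @stieltjes_measure_exists R (fun l => nr (E l x) ^+ 2).
- by move=> l m lm; exact: mono_proj_nd.
- move=> l e e0.
  have m0 : 0 < Num.min 1 e by rewrite lt_min ltr01.
  have [N hN] := Eright l x m0; exists N.+1%:R^-1; first exact: invn_pos.
  have := hN N (leqnn N); rewrite subr0 -ltrBlDl -(Eitv_sqr Ep Emono) ?lerDl ?ltW ?invn_pos //.
  rewrite -/(Eitv E l (l + N.+1%:R^-1) x); set v := Eitv _ _ _ _.
  rewrite lt_min => /andP[h1 h2]; apply: le_lt_trans h2.
  by rewrite expr2 ler_piMr ?nr_ge0 // ltW.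
by exists mu => a b ab; rewrite hmu // (Eitv_sqr Ep Emono).
Qed.

Let ocitvR := [set `]ab.1, ab.2]%classic | ab in [set: R * R]].

Lemma cvgs_sqr (u : nat -> H) x : cvgs u x -> (fun n => nr (u n) ^+ 2) @ \oo --> nr x ^+ 2.
Proof. by move=> /cvgs_nr ux; apply: cvgM. Qed.

Section OneSet.
Variable mu : H -> {measure set (measurableTypeR R) -> \bar R}.
Hypothesis mu_itv : forall x a b, a <= b -> mu x `]a, b]%classic = (nr (Eitv E a b x) ^+ 2)%:E.

Lemma spectral_measureT x : mu x setT = (nr x ^+ 2)%:E.
Proof.
have c1 : (mu x \o symitv) @ \oo --> mu x (\bigcup_n symitv n).
  apply: nondecreasing_cvg_mu => //.
  - by move=> n; exact: measurable_itv.
  - by apply: bigcup_measurable => n _; exact: measurable_itv.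
  - by move=> n k nk; apply/subsetPset; exact: symitv_nd.
have c2 : (mu x \o symitv) @ \oo --> (nr x ^+ 2)%:E.
  have -> : mu x \o symitv = EFin \o (fun n => nr (Eitv E (- n.+1%:R) n.+1%:R x) ^+ 2).
    by apply/funext => n /=; rewrite mu_itv ?symitv_le.
  apply: cvg_EFin; first by near=> n.
  by apply: cvgs_sqr; exact: Eitv_symitv_cvg.
by have := cvg_unique _ c1 c2; rewrite bigcup_symitv; apply.
Unshelve. all: by end_near. Qed.

(** If x is fixed by Q j, then Q i x and Q j x = x have squared norms of sum at
    most |x|^2, the total mass of mu x. Hence Q i x = 0: disjoint sets have
    orthogonal projections, whose sum belongs to the union. *)
Lemma disjoint_projections (F : nat -> set (measurableTypeR R)) (Q : nat -> H -> H) :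
  (forall n, measurable (F n)) -> trivIset setT F -> (forall n, isproj (Q n)) ->
  (forall n x, mu x (F n) = (nr (Q n x) ^+ 2)%:E) ->
  exists P, [/\ isproj P, forall x, cvgs (fun n => \sum_(0 <= k < n) Q k x) (P x) &
    forall x, mu x (\bigcup_n F n) = (nr (P x) ^+ 2)%:E].
Proof.
move=> mF tF Qp hmu.
have Qorth i j x : i != j -> Q i (Q j x) = 0.
  move=> ij; have FF : F i `&` F j = set0.
    by move/trivIsetP : tF => /(_ i j I I ij).
  have : (mu (Q j x) (F i `|` F j) <= mu (Q j x) setT)%E.
    by apply: le_measure; rewrite ?inE //; exact: measurableU.
  rewrite measureU // spectral_measureT [X in (X + _)%E]hmu [X in (_ + X)%E]hmu.
  rewrite (proj_idem (Qp j)) -EFinD lee_fin.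
  by rewrite gerDr => h; apply: nr_eq0; apply/eqP; rewrite -sqrf_eq0 eq_le h sqr_ge0.
have [P [Pp SP]] := proj_sum_exists Qp Qorth.
exists P; split=> // x.
have c1 : (fun n => \sum_(0 <= k < n) mu x (F k))%E @ \oo --> mu x (\bigcup_k F k).
  by apply: measure_semi_sigma_additive => //; exact: bigcup_measurable.
have c2 : (fun n => \sum_(0 <= k < n) mu x (F k))%E @ \oo --> (nr (P x) ^+ 2)%:E.
  have -> : (fun n => \sum_(0 <= k < n) mu x (F k))%E =
    EFin \o (fun n => nr (\sum_(0 <= k < n) Q k x) ^+ 2).
    apply/funext => n /=; rewrite (proj_sum_sqr Qp Qorth) -sumEFin.
    by apply: eq_bigr => k _; rewrite hmu.
  by apply: cvg_EFin; [near=> n|exact: cvgs_sqr].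
exact: (cvg_unique _ c1 c2).
Unshelve. all: by end_near. Qed.

(** The sets W for which x |-> mu x W is the quadratic form of a projection form
    a Dynkin class; it contains the intervals ]a, b], which are stable under
    intersection and generate the Borel sets. *)
Lemma spectral_projection_exists (W : set (measurableTypeR R)) : measurable W ->
  exists Q, isproj Q /\ forall x, mu x W = (nr (Q x) ^+ 2)%:E.
Proof.
have proj00 : isproj (fun _ : H => 0 : H).
  by split=> [a x y|x|x y] //; rewrite ?scaler0 ?addr0 // dot0l dot0r.
move=> mW; apply: (@dynkin_induction _ _ ocitvR (fun W => exists Q, isproj Q /\
    forall x, mu x W = (nr (Q x) ^+ 2)%:E)) => //.
- exact: ocitvI.
- by exists id; split=> [|x]; [split|rewrite spectral_measureT].
- move=> _ [[a b] _ <-] /=; have [ab|ba] := leP a b.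
    by exists (Eitv E a b); split=> [|x]; [exact: Eitvp|rewrite mu_itv].
  exists (fun=> 0); split=> // x; rewrite set_itv_ge ?measure0 ?nr0 ?expr0n //.
  by rewrite bnd_simp -leNgt ltW.
- move=> S mS [Q [Qp hQ]]; exists (fun x => x - Q x); split; first exact: proj_compl.
  move=> x; rewrite -setTD measureD // ?setTI; last first.
    by rewrite [ltLHS]spectral_measureT ltry.
  rewrite [X in (X - _)%E]spectral_measureT [X in (_ - X)%E]hQ.
  by rewrite (proj_pythagoras Qp x) -EFinB addrAC subrr add0r.
move=> F mF tF /choice [Q hQ].
have [P [Pp _ hP]] := disjoint_projections mF tF (fun n => proj1 (hQ n)) (fun n => proj2 (hQ n)).
by exists P.
Qed.

End OneSet.

Lemma pvm_exists : exists P : projection_valued_measure (measurableTypeR R) H,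
  forall a b, a <= b -> forall x, P `]a, b]%classic x = Eitv E a b x.
Proof.
have /choice [mu mu_itv] := spectral_measure_exists.
have /choice [P hP] (W : set (measurableTypeR R)) : exists T : bounded_operator H, measurable W ->
    isproj T /\ forall x, mu x W = (nr (T x) ^+ 2)%:E.
  have [mW|nW] := pselect (measurable W); last first.
    have p0 : isproj (id : H -> H) by split.
    by have [T _] := bounded_operator_exists p0; exists T.
  have [Q [Qp hQ]] := spectral_projection_exists mu_itv mW.
  have [T hT] := bounded_operator_exists Qp; exists T => _.
  have -> : (T : H -> H) = Q by apply/funext.
  by split=> // x; rewrite hQ.
have Pp W : measurable W -> isproj (P W) by move=> /(hP W) [].
have muP W x : measurable W -> mu x W = (nr (P W x) ^+ 2)%:E by move=> /(hP W) [].
have P_proj W : measurable W -> orthogonal_projection (P W).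
  move=> mW; split=> [x|x y]; first exact: (proj_idem (Pp _ mW)).
  apply: inner_dot_eq => a; rewrite (proj_sym (Pp _ mW)).
  by rewrite (clinZ _ _ (proj_clin (Pp _ mW))).
have P0 x : P set0 x = 0.
  have := muP set0 x measurable0; rewrite measure0 => -[/eqP].
  by rewrite eq_sym sqrf_eq0 => /eqP /nr_eq0.
have PT x : P setT x = x.
  have := muP setT x measurableT; rewrite spectral_measureT // => -[e].
  have := proj_pythagoras (Pp _ measurableT) x; rewrite -e => e2.
  have /eqP : nr (x - P setT x) ^+ 2 = 0 by lra.
  by rewrite sqrf_eq0 => /eqP /nr_eq0 /eqP; rewrite subr_eq0 eq_sym => /eqP.
have Psa (F : nat -> set (measurableTypeR R)) : (forall n, measurable (F n)) -> trivIset setT F ->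
    forall x, (fun n => \sum_(0 <= k < n) P (F k) x) @ \oo --> P (\bigcup_n F n) x.
  move=> mF tF x; apply/cvgs_cvg.
  have mU : measurable (\bigcup_n F n) by exact: bigcup_measurable.
  have [Q [Qp SQ hQ]] := disjoint_projections mu_itv mF tF (fun n => Pp _ (mF n))
    (fun n y => muP _ y (mF n)).
  suff -> : P (\bigcup_n F n) x = Q x by exact: SQ.
  apply: proj_eq => // [|y]; first exact: Pp.
  rewrite (proj_dot (Pp _ mU)) (proj_dot Qp).
  by have := muP _ y mU; rewrite hQ => -[].
exists (ProjectionValuedMeasure P_proj P0 PT Psa) => a b ab x /=.
apply: proj_eq => [||y]; first by apply: Pp; exact: measurable_itv.
  exact: Eitvp.
have mI : measurable (`]a, b]%classic : set (measurableTypeR R)) by exact: measurable_itv.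
rewrite (proj_dot (Pp _ mI)) (proj_dot (Eitvp ab)).
by have := muP _ y mI; rewrite mu_itv // => -[].
Qed.

End ResolutionOfIdentity.

(** * Integrals over intervals *)

Section Bisection.
Context {R : realType}.

(** Each bisection halves the bound on an additive function of intervals. Applied
    to the difference between an integral and its expected value, this argument
    takes the place of Riemann sums. *)
Lemma bisection_eq0 (g k : R -> R -> R) (C L U : R) :
  0 <= C ->
  (forall a b c, a <= b -> b <= c -> g a c = g a b + g b c) ->
  (forall a b c, a <= b -> b <= c -> k a b + k b c <= k a c) ->
  (forall a b, L <= a -> a <= b -> b <= U -> `|g a b| <= C * (b - a) * k a b) ->
  forall a b, L <= a -> a <= b -> b <= U -> g a b = 0.
Proof.
move=> C0 gD kD gk.
have h n : forall a b, L <= a -> a <= b -> b <= U ->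
    `|g a b| <= C * (b - a) / 2 ^+ n * k a b.
  elim: n => [|n IH] a b La ab bU; first by rewrite expr0 divr1; exact: gk.
  pose c := (a + b) / 2; have ac : a <= c by rewrite /c; lra.
  have cb : c <= b by rewrite /c; lra.
  have := IH a c La ac (le_trans cb bU); have := IH c b (le_trans La ac) cb bU.
  have -> : c - a = (b - a) / 2 by rewrite /c; lra.
  have -> : b - c = (b - a) / 2 by rewrite /c; lra.
  rewrite (gD _ _ _ ac cb) => h1 h2; apply: (le_trans (ler_normD _ _)).
  apply: (le_trans (lerD h2 h1)); rewrite -mulrDr.
  have -> : C * ((b - a) / 2) / 2 ^+ n = C * (b - a) / 2 ^+ n.+1.
    by rewrite exprS; field; rewrite expf_neq0.
  apply: ler_wpM2l; last exact: kD.
  by rewrite !mulr_ge0 ?subr_ge0 // invr_ge0 exprn_ge0.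
move=> a b La ab bU; apply/eqP; rewrite -normr_eq0 eq_le normr_ge0 andbT.
set K := C * (b - a) * k a b.
have fl : (fun n : nat => K / 2 ^+ n) @ \oo --> (0 : R).
  rewrite -[X in _ --> X](mulr0 K); apply: cvgMr.
  have -> : (fun n : nat => 2 ^- n) = (fun n : nat => 2^-1 ^+ n) :> (nat -> R).
    by apply/funext => n; rewrite exprVn.
  by apply: cvg_expr; rewrite ger0_norm //; lra.
rewrite -(cvg_lim _ fl) //; apply: limr_ge; first by apply: cvgP fl.
by near=> n; rewrite /K mulrAC; exact: h.
Unshelve. all: by end_near. Qed.

End Bisection.

Section Integration.
Context {R : realType} (mu : {measure set (measurableTypeR R) -> \bar R}).
Hypothesis mu_fin : (mu setT < +oo)%E.
Implicit Types (f : R -> R) (a b c d : R) (W : set (measurableTypeR R)).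

Let mu_itv W : measurable W -> (mu W < +oo)%E.
Proof. by move=> mW; apply: le_lt_trans mu_fin; apply: le_measure; rewrite ?inE. Qed.

Let mitv a b : measurable (`]a, b]%classic : set (measurableTypeR R)).
Proof. exact: measurable_itv. Qed.

Lemma bounded_integrable f W c : measurable W -> measurable_fun setT (f : measurableTypeR R -> R) ->
  (forall t, W t -> `|f t| <= c) -> mu.-integrable W (EFin \o f).
Proof.
move=> mW mf fc; apply: measurable_bounded_integrable => //.
- exact: mu_itv.
- exact: measurable_funTS.
by exists c; split; rewrite ?num_real // => x cx y Wy /=; apply: (le_trans (fc _ Wy)); exact: ltW.
Qed.

Lemma Rintegral_near_cst f W c d : measurable W -> measurable_fun setT (f : measurableTypeR R -> R) ->
  (forall t, W t -> `|f t - c| <= d) ->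
  `| \int[mu]_(t in W) f t - c * fine (mu W) | <= d * fine (mu W).
Proof.
move=> mW mf fd.
have fi : mu.-integrable W (EFin \o f).
  apply: (@bounded_integrable _ _ (`|c| + d)) => // t Wt.
  by rewrite -[f t](subrK c) (le_trans (ler_normD _ _)) // addrC lerD2l fd.
have ci r : mu.-integrable W (EFin \o (fun=> r)).
  by apply: (@bounded_integrable _ _ `|r|) => //; exact: measurable_cst.
have h1 : \int[mu]_(t in W) (c - d) <= \int[mu]_(t in W) f t.
  by apply: le_Rintegral => // t /fd; rewrite ler_norml; lra.
have h2 : \int[mu]_(t in W) f t <= \int[mu]_(t in W) (c + d).
  by apply: le_Rintegral => // t /fd; rewrite ler_norml; lra.
move: h1 h2; rewrite !Rintegral_cst // ler_norml => h1 h2; apply/andP; split; lra.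
Qed.

Lemma itv_oc_setU a b c : a <= b -> b <= c ->
  `]a, c]%classic = `]a, b]%classic `|` `]b, c]%classic :> set R.
Proof. by move=> ab bc; rewrite -itv_bndbnd_setU // bnd_simp. Qed.

Lemma itv_oc_disj a b c : `]a, b]%classic `&` `]b, c]%classic = set0 :> set R.
Proof.
rewrite -subset0 => t [] /=; rewrite !in_itv /= => /andP[_ tb] /andP[bt _].
by have := lt_le_trans bt tb; rewrite ltxx.
Qed.

Lemma Rintegral_itv_add f a b c : a <= b -> b <= c ->
  mu.-integrable `]a, c]%classic (EFin \o f) ->
  \int[mu]_(t in `]a, c]) f t = \int[mu]_(t in `]a, b]) f t + \int[mu]_(t in `]b, c]) f t.
Proof.
move=> ab bc; rewrite (itv_oc_setU ab bc) => fi; rewrite Rintegral_setU //.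
by apply/disj_setPS => t; rewrite itv_oc_disj.
Qed.

Lemma integral_le_symitv f (C : R) : measurable_fun setT (f : measurableTypeR R -> R) ->
  (forall t, 0 <= f t) ->
  (forall n, \int[mu]_(t in symitv n) (f t)%:E <= C%:E)%E ->
  (\int[mu]_t (f t)%:E <= C%:E)%E.
Proof.
move=> mf f0 fC.
have fl : (\int[mu]_(t in symitv n) (f t)%:E)%E @[n --> \oo] -->
    (\int[mu]_(t in \bigcup_n symitv n) (f t)%:E)%E.
  apply: ge0_nondecreasing_set_cvg_integral.
  - by move=> n k nk; apply/subsetPset; exact: symitv_nd.
  - by move=> n; exact: mitv.
  - by move=> n; apply/measurable_EFinP; exact: measurable_funTS.
  - by move=> n t _; rewrite lee_fin.
rewrite -bigcup_symitv -(cvg_lim _ fl) //; apply: lime_le; first by apply: cvgP fl.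
by near=> n; exact: fC.
Unshelve. all: by end_near. Qed.

Lemma Rintegral_symitv_cvg f : mu.-integrable setT (EFin \o f) ->
  (fun n => \int[mu]_(t in symitv n) f t) @ \oo --> \int[mu]_t f t.
Proof.
move=> fi; have mf : measurable_fun setT (EFin \o f) := measurable_int _ fi.
have mI n : measurable (symitv n : set (measurableTypeR R)) by exact: measurable_itv.
apply: fine_cvg; rewrite fineK; last exact: integrable_fin_num.
rewrite (_ : (fun n => _) = (fun n => \int[mu]_t ((EFin \o f) \_ (symitv n)) t)%E); last first.
  by apply/funext => n; rewrite -integral_mkcond.
apply: (@dominated_cvg _ _ _ mu setT measurableT (fun n => (EFin \o f) \_ (symitv n))
  (EFin \o f) (abse \o (EFin \o f))).
- by move=> n; apply/measurable_restrict => //; rewrite setTI; exact: measurable_funTS.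
- move=> t _; have [N _ tN] : (\bigcup_n (symitv n : set R)) t by rewrite bigcup_symitv.
  apply: (cvg_near_cst); exists N => // n /= Nn.
  by rewrite patchE mem_set //; apply: symitv_nd Nn _ tN.
- by [].
- exact: integrable_abse.
- by move=> n t _; rewrite patchE; case: ifP => //= _; rewrite normr0 lee_fin.
Unshelve. all: by end_near. Qed.

End Integration.

(** * Moments of the spectral measures *)

Section PVM.
Context {R : realType} {H : hilbertType R}.
Variable P : projection_valued_measure (measurableTypeR R) H.
Implicit Types (x y z w : H) (W : set (measurableTypeR R)).

Lemma pvm_isproj W : measurable W -> isproj (P W).
Proof.
move=> mW; have [PP Ps] := pvm_projection P mW.
by split=> [a x y||x y]; [exact: linearP|exact: PP|rewrite /dot Ps].
Qed.

Lemma pvmU W W' x : measurable W -> measurable W' -> W `&` W' = set0 ->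
  P (W `|` W') x = P W x + P W' x.
Proof.
move=> mW mW' WW'; apply: dot_inj => y; rewrite dotDr.
by have := chargeU (re_charge (pvm_cmeasure P x y)) mW mW' WW' => -[].
Qed.

(** The projection of the union of W and W' is P W + P W', which must not
    increase the norm of P W' x. *)
Lemma pvm_disjoint W W' x : measurable W -> measurable W' -> W `&` W' = set0 ->
  P W (P W' x) = 0.
Proof.
move=> mW mW' WW'; have mU := measurableU _ _ mW mW'.
have := proj_nr (pvm_isproj mU) (P W' x).
rewrite -(@ler_pXn2r _ 2) ?nnegrE ?nr_ge0 // -(proj_dot (pvm_isproj mU)) pvmU // dotDr.
rewrite (proj_dot (pvm_isproj mW)) (proj_dot (pvm_isproj mW')) (proj_idem (pvm_isproj mW')).
rewrite gerDr => h; apply: nr_eq0; apply/eqP.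
by rewrite -sqrf_eq0 eq_le h sqr_ge0.
Qed.

Lemma pvmI W W' x : measurable W -> measurable W' -> P (W `&` W') x = P W (P W' x).
Proof.
move=> mW mW'.
have mI : measurable (W `&` W') by exact: measurableI.
have mD : measurable (W `\` W') by exact: measurableD.
have mD' : measurable (W' `\` W) by exact: measurableD.
have d1 : (W `&` W') `&` (W' `\` W) = set0 by rewrite -subset0 => t [[? _] [_]].
have d2 : (W `&` W') `&` (W `\` W') = set0 by rewrite -subset0 => t [[_ ?] [_]].
have d3 : W `&` (W' `\` W) = set0 by rewrite -subset0 => t [? [_]].
have -> : P W' x = P (W `&` W') x + P (W' `\` W) x.
  by rewrite -pvmU // setIC setUIDK.
rewrite (projD (pvm_isproj mW)) (pvm_disjoint _ mW mD' d3) addr0.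
have PWE z : P W z = P (W `&` W') z + P (W `\` W') z by rewrite -pvmU // setUIDK.
rewrite PWE (proj_idem (pvm_isproj mI)) pvm_disjoint ?addr0 //.
by rewrite setIC.
Qed.

Lemma pvm_measureE x W : measurable W -> pvm_measure P x W = (nr (P W x) ^+ 2)%:E.
Proof.
by move=> mW; rewrite /pvm_measure mem_set //= -(proj_dot (pvm_isproj mW)).
Qed.

Lemma pvm_measure_fin x : (pvm_measure P x setT < +oo)%E.
Proof. by rewrite pvm_measureE // ltry. Qed.

End PVM.

Section Moments.
Context {R : realType} {H : hilbertType R}.
Variables (D : set H) (A : H -> H) (sa : selfadj D A).
Variables (E : R -> H -> H) (sf : spectral_family D A E).
Variable P : projection_valued_measure (measurableTypeR R) H.
Hypothesis PE : forall a b, a <= b -> forall x, P `]a, b]%classic x = Eitv E a b x.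
Implicit Types (x y z w : H) (W : set (measurableTypeR R)).

Let Ep (a b : R) (ab : a <= b) := Eitv_proj (sf_proj sf) (sf_mono sa sf) ab.
Let mitv (a b : R) : measurable (`]a, b]%classic : set (measurableTypeR R)).
Proof. exact: measurable_itv. Qed.

Let mid : measurable_fun setT (id : measurableTypeR R -> R).
Proof. exact: measurable_id. Qed.

Let itv_dist (a b t : R) : t \in `]a, b] -> `|t - a| <= b - a.
Proof. by rewrite in_itv /= ler_norml => /andP[h1 h2]; apply/andP; split; lra. Qed.

Let itv_bd (a b t : R) : t \in `]a, b] -> `|t| <= `|a| + `|b|.
Proof.
rewrite in_itv /= ler_norml => /andP[h1 h2].
have := ler_norm b; have := ler_norm (- a); rewrite normrN.
by have := normr_ge0 a; have := normr_ge0 b => *; apply/andP; split; lra.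
Qed.

(** With I = ]u, v], both the integral over I and <y, A E_I x> differ from
    u <y, E_I x> by at most a multiple of v - u times an additive function of I. *)
Lemma first_moment_itv (m : {measure set (measurableTypeR R) -> \bar R}) x y :
  (forall W, measurable W -> m W = (dot y (P W x))%:E) ->
  forall a b, a <= b -> \int[m]_(t in `]a, b]) t = dot y (A (Eitv E a b x)).
Proof.
move=> mE a b ab.
have mfin : (m setT < +oo)%E by rewrite mE // ltry.
pose g u v := \int[m]_(t in `]u, v]) t - dot y (A (Eitv E u v x)).
pose k u v := dot y (Eitv E u v x) + (nr (E v y) ^+ 2 - nr (E u y) ^+ 2) / 2
  + (nr (E v x) ^+ 2 - nr (E u x) ^+ 2) / 2.
suff : g a b = 0 by rewrite /g => /eqP; rewrite subr_eq0 => /eqP.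
apply: (@bisection_eq0 _ g k 1 a b) => // {ab}.
- move=> u v w uv vw; rewrite /g (@Rintegral_itv_add _ m id u v w) //; last first.
    by apply: (bounded_integrable mfin (c := `|u| + `|w|)) => // t; exact: itv_bd.
  rewrite (Eitv_add _ u v w) (sa_opD sa) ?dotDr; [ring| |]; exact: (Eitv_dom sa sf).
- by move=> u v w uv vw; rewrite /k (Eitv_add _ u v w) dotDr; lra.
move=> u v _ uv _; rewrite mul1r.
have mq : fine (m `]u, v]%classic) = dot y (Eitv E u v x) by rewrite mE // PE.
have := @Rintegral_near_cst _ m mfin id _ u (v - u) (mitv u v) mid (@itv_dist u v).
rewrite mq => h1.
set Px := Eitv E u v x in h1 *; set q := dot y Px in h1 *.
have h2 : `|dot y (A Px) - u * q| <= nr (Eitv E u v y) * ((v - u) * nr Px).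
  have -> : dot y (A Px) - u * q = dot (Eitv E u v y) (A Px - u%:C *: Px).
    have DPx : D Px by exact: (Eitv_dom sa sf).
    have [_ AP] := Eitv_comm sa sf u v DPx.
    rewrite (proj_sym (Ep uv)) (projB (Ep uv)) -AP (clinZ _ _ (proj_clin (Ep uv))).
    by rewrite (proj_idem (Ep uv)) dotBr dotZr.
  apply: (le_trans (ler_dot _ _)); apply: ler_wpM2l; first exact: nr_ge0.
  exact: (Eitv_bound sa sf).
have h3 : nr (Eitv E u v y) * nr Px <=
    (nr (E v y) ^+ 2 - nr (E u y) ^+ 2) / 2 + (nr (E v x) ^+ 2 - nr (E u x) ^+ 2) / 2.
  rewrite -!(Eitv_sqr (sf_proj sf) (sf_mono sa sf)) // -/Px.
  have := sqr_ge0 (nr (Eitv E u v y) - nr Px).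
  by rewrite sqrrB; lra.
have uv0 : 0 <= v - u by rewrite subr_ge0.
have := ler_wpM2l uv0 h3.
have -> : g u v = (\int[m]_(t in `]u, v]) t - u * q) - (dot y (A Px) - u * q).
  by rewrite /g; ring.
have := ler_normB (\int[m]_(t in `]u, v]) t - u * q) (dot y (A Px) - u * q).
rewrite /k -/Px -/q; lra.
Qed.

(** As for the first moment, with u^2 |E_I x|^2 in the middle: on E_I the operator
    A is u up to v - u, so |A E_I x|^2 - u^2 |E_I x|^2 is of the order of
    (v - u) |E_I x|^2. *)
Lemma second_moment_itv x a b : a <= b ->
  \int[pvm_measure P x]_(t in `]a, b]) (t ^+ 2) = nr (A (Eitv E a b x)) ^+ 2.
Proof.
move=> ab; set m := pvm_measure P x.
have mfin : (m setT < +oo)%E by exact: pvm_measure_fin.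
pose g u v := \int[m]_(t in `]u, v]) (t ^+ 2) - nr (A (Eitv E u v x)) ^+ 2.
pose k u v := nr (E v x) ^+ 2 - nr (E u x) ^+ 2.
pose M := `|a| + `|b|.
suff : g a b = 0 by rewrite /g => /eqP; rewrite subr_eq0 => /eqP.
have M0 : 0 <= M by rewrite addr_ge0.
have m2 : measurable_fun setT (fun t : measurableTypeR R => (t ^+ 2 : R)).
  exact: measurable_funX.
apply: (@bisection_eq0 _ g k (6 * M) a b) => //.
- by rewrite mulr_ge0.
- move=> u v w uv vw; rewrite /g (@Rintegral_itv_add _ m (fun t => t ^+ 2) u v w) //; last first.
    apply: (bounded_integrable mfin (c := (`|u| + `|w|) ^+ 2)) => // t /itv_bd h.
    by rewrite normrX ler_pXn2r ?nnegrE // addr_ge0.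
  rewrite (Eitv_add _ u v w) (sa_opD sa); try exact: (Eitv_dom sa sf).
  have D1 : D (Eitv E u v x) by exact: (Eitv_dom sa sf).
  have [_ AP] := Eitv_comm sa sf u v D1.
  rewrite nrD_sqr -(proj_idem (Ep uv) x) AP (proj_sym (Ep uv)).
  have D2 : D (Eitv E v w x) by exact: (Eitv_dom sa sf).
  have [_ <-] := Eitv_comm sa sf u v D2.
  have -> : Eitv E u v (Eitv E v w x) = 0.
    rewrite /Eitv (projB (sf_proj sf _)) (projB (sf_proj sf _)) (proj_idem (sf_proj sf _)).
    by rewrite !(sf_mono sa sf) // ?(le_trans uv) // !subrr.
  by rewrite (sa_op0 sa) dot0r mulr0 addr0 -AP (proj_idem (Ep uv)); ring.
- by move=> u v w _ _; rewrite /k; lra.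
move=> u v au uv vb; have uv0 : 0 <= v - u by rewrite subr_ge0.
have uM : `|u| <= M.
  rewrite /M ler_norml; have := ler_norm b; have := ler_norm (- a); rewrite normrN.
  by have := normr_ge0 a; have := normr_ge0 b => *; apply/andP; split; lra.
have vuM : v - u <= 2 * M.
  rewrite /M; have := ler_norm b; have := ler_norm (- a); rewrite normrN.
  by have := normr_ge0 a; have := normr_ge0 b => *; lra.
set Px := Eitv E u v x; pose q := nr Px ^+ 2.
have kq : k u v = q by rewrite /k -(Eitv_sqr (sf_proj sf) (sf_mono sa sf)).
have mq : fine (m `]u, v]%classic) = q by rewrite /m pvm_measureE //= PE.
have h1 : `|\int[m]_(t in `]u, v]) (t ^+ 2) - u ^+ 2 * q| <= (2 * M * (v - u)) * q.
  rewrite -mq; apply: (@Rintegral_near_cst _ m mfin (fun t => t ^+ 2)) => // t /= tuv.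
  rewrite subr_sqr mulrC normrM; apply: ler_pM; rewrite ?normr_ge0 //; last exact: itv_dist.
  apply: (le_trans (ler_normD _ _)); rewrite mulr_natl mulr2n lerD //.
  move: tuv; rewrite in_itv /= => /andP[ut tv].
  rewrite /M ler_norml; have := ler_norm b; have := ler_norm (- a); rewrite normrN.
  by have := normr_ge0 a; have := normr_ge0 b => *; apply/andP; split; lra.
have h2 : `|nr (A Px) ^+ 2 - u ^+ 2 * q| <= 4 * M * (v - u) * q.
  pose r := A Px - u%:C *: Px.
  have rb : nr r <= (v - u) * nr Px by exact: (Eitv_bound sa sf).
  have -> : nr (A Px) ^+ 2 - u ^+ 2 * q = nr r ^+ 2 + 2 * u * dot Px r.
    have -> : A Px = r + u%:C *: Px by rewrite /r subrK.
    rewrite nrD_sqr dotZr nrZ exprMn real_normK ?num_real // (dotC r) /q; ring.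
  apply: (le_trans (ler_normD _ _)); rewrite ger0_norm ?sqr_ge0 // !normrM.
  rewrite (ger0_norm (_ : 0 <= 2)) //.
  have e1 : nr r ^+ 2 <= 2 * M * (v - u) * q.
    rewrite expr2 (le_trans (ler_pM (nr_ge0 _) (nr_ge0 _) rb rb)) //.
    have -> : (v - u) * nr Px * ((v - u) * nr Px) = (v - u) * ((v - u) * q) by rewrite /q; ring.
    have q0 : 0 <= q by exact: sqr_ge0.
    by have := ler_wpM2r (mulr_ge0 uv0 q0) vuM; lra.
  have e2 : 2 * `|u| * `|dot Px r| <= 2 * M * (v - u) * q.
    have d1 : `|dot Px r| <= (v - u) * q.
      rewrite (le_trans (ler_dot _ _)) // (le_trans (ler_wpM2l (nr_ge0 _) rb)) //.
      by rewrite le_eqVlt /q; apply/orP; left; apply/eqP; ring.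
    by have := ler_pM (normr_ge0 u) (normr_ge0 (dot Px r)) uM d1; lra.
  lra.
have -> : g u v = (\int[m]_(t in `]u, v]) (t ^+ 2) - u ^+ 2 * q) - (nr (A Px) ^+ 2 - u ^+ 2 * q).
  by rewrite /g; ring.
rewrite kq (le_trans (ler_normB _ _)) // (le_trans (lerD h1 h2)) // le_eqVlt.
by apply/orP; left; apply/eqP; ring.
Qed.

End Moments.

Section Integral.
Context {R : realType} {H : hilbertType R}.
Variables (D : set H) (A : H -> H) (sa : selfadj D A).
Variables (E : R -> H -> H) (sf : spectral_family D A E).
Variable P : projection_valued_measure (measurableTypeR R) H.
Hypothesis PE : forall a b, a <= b -> forall x, P `]a, b]%classic x = Eitv E a b x.
Implicit Types (x y z w : H) (W : set (measurableTypeR R)).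

Let Qs n x := Eitv E (- n.+1%:R) n.+1%:R x.

Let Qs_proj n : isproj (Qs n).
Proof. exact: (Eitv_proj (sf_proj sf) (sf_mono sa sf) (symitv_le n)). Qed.

Let Qs_cvg x : cvgs (fun n => Qs n x) x.
Proof.
by apply: Eitv_symitv_cvg; [exact: (sf_cvg_pinfty sa sf)|exact: (sf_cvg_ninfty sa sf)].
Qed.

Let msym n : measurable (symitv n : set (measurableTypeR R)).
Proof. exact: measurable_itv. Qed.

Lemma second_moment_symitv x n :
  (\int[pvm_measure P x]_(t in symitv n) (t ^+ 2)%:E = (nr (A (Qs n x)) ^+ 2)%:E)%E.
Proof.
rewrite -(second_moment_itv sa sf PE x (symitv_le n)) /Rintegral fineK //.
apply: integrable_fin_num => //.
apply: (@bounded_integrable _ (pvm_measure P x) _ _ _ (n.+1%:R ^+ 2)) => //.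
  exact: pvm_measure_fin.
move=> t; rewrite /= in_itv /= => /andP[t1 t2]; rewrite normrX ler_pXn2r ?nnegrE //.
by rewrite ler_norml t2 ltW.
Qed.

(** The integral is the limit of |A E_I x|^2 over symmetric intervals I. It is at
    most |A x|^2 for x in the domain. If it is finite, then the limit of
    <A E_I x, y> = <E_I x, A y> bounds the functional y |-> <x, A y>, and the
    maximality of the domain applies. *)
Lemma square_integrable_domain x :
  (\int[pvm_measure P x]_t (t ^+ 2)%:E < +oo)%E <-> D x.
Proof.
have m2 : measurable_fun setT (fun t : measurableTypeR R => (t ^+ 2 : R)).
  exact: measurable_funX.
split=> [fin|Dx].
- set I2 := (\int[_]_t _)%E in fin.
  have I0 : (0 <= I2)%E by apply: integral_ge0 => t _; rewrite lee_fin sqr_ge0.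
  have If : I2 \is a fin_num by rewrite ge0_fin_numE.
  have bd n : nr (A (Qs n x)) <= Num.sqrt (fine I2).
    rewrite -[leLHS]ger0_norm ?nr_ge0 // -sqrtr_sqr ler_wsqrtr //.
    rewrite -lee_fin fineK // -second_moment_symitv.
    apply: ge0_subset_integral => //.
      exact/measurable_EFinP.
    by move=> t _; rewrite lee_fin sqr_ge0.
  apply: (sa_max sa (M := Num.sqrt (fine I2))) => y Dy.
  have fl := cvgs_dot (y := A y) (Qs_cvg x).
  rewrite dotC -(cvg_lim _ fl) //; apply: limr_le; first by apply: cvgP fl.
  near=> n; rewrite (sa_sym sa) //; last exact: (Eitv_dom sa sf _ (symitv_le n)).
  by rewrite dotC (le_trans (ler_dotW _ _)) // ler_wpM2r ?nr_ge0.
apply: (@le_lt_trans _ _ (nr (A x) ^+ 2)%:E); last exact: ltry.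
apply: integral_le_symitv => // [t|n]; first exact: sqr_ge0.
rewrite second_moment_symitv lee_fin ler_pXn2r ?nnegrE ?nr_ge0 //.
have [_ ->] := Eitv_comm sa sf (- n.+1%:R) n.+1%:R Dx.
exact: (proj_nr (Qs_proj n)).
Unshelve. all: by end_near. Qed.

(** On symmetric intervals I the moment is <y, A E_I x> = <y, E_I A x>, and A x
    exists. Integrability comes from the same identity on both sides of 0. *)
Lemma first_moment (m : {measure set (measurableTypeR R) -> \bar R}) x y :
  (forall W, measurable W -> m W = (dot y (P W x))%:E) -> D x ->
  \int[m]_t t = dot y (A x).
Proof.
move=> mE Dx; have mfin : (m setT < +oo)%E by rewrite mE // ltry.
have AQ a b : A (Eitv E a b x) = Eitv E a b (A x) by case: (Eitv_comm sa sf a b Dx).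
have bd a b : a <= b -> `|dot y (A (Eitv E a b x))| <= nr y * nr (A x).
  move=> ab; rewrite (le_trans (ler_dot _ _)) // ler_wpM2l ?nr_ge0 // AQ.
  exact: (proj_nr (Eitv_proj (sf_proj sf) (sf_mono sa sf) ab)).
have ii (a b : R) (f : R -> R) : measurable_fun setT (f : measurableTypeR R -> R) ->
    (forall t, `|f t| <= `|t|) -> m.-integrable `]a, b]%classic (EFin \o f).
  move=> mf ft; apply: (bounded_integrable mfin (c := `|a| + `|b|)) => // t.
  rewrite /= in_itv /= => /andP[t1 t2]; apply: (le_trans (ft t)); rewrite ler_norml.
  have := ler_norm b; have := ler_norm (- a); rewrite normrN.
  by have := normr_ge0 a; have := normr_ge0 b => *; apply/andP; split; lra.
have mabs : measurable_fun setT ((fun t => `|t|) : measurableTypeR R -> R).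
  exact: measurableT_comp.
have fi : m.-integrable setT (EFin \o id).
  apply/integrableP; split; first exact/measurable_EFinP.
  apply: (@le_lt_trans _ _ (2 * (nr y * nr (A x)))%:E); last exact: ltry.
  apply: (@integral_le_symitv _ m (fun t => `|t|)) => // n.
  have nn : (0 : R) <= n.+1%:R by [].
  have nn' : - n.+1%:R <= 0 :> R by rewrite oppr_le0.
  have I1 : m.-integrable (symitv n) (EFin \o (fun t => `|t|)).
    by apply: ii => // t; rewrite normr_id.
  rewrite -[leLHS]fineK; last by exact: integrable_fin_num.
  rewrite lee_fin -/(Rintegral m (symitv n) (fun t => `|t|)).
  rewrite (Rintegral_itv_add nn' nn I1).
  have -> : \int[m]_(t in `]- n.+1%:R, 0]) `|t| = - \int[m]_(t in `]- n.+1%:R, 0]) t.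
    have -> : - (\int[m]_(t in `]- n.+1%:R, 0]) t) = \int[m]_(t in `]- n.+1%:R, 0]) (-1 * (t : R)).
      by rewrite (@RintegralZl _ _ _ m _ id) ?mulN1r //; exact: ii.
    apply: eq_Rintegral => t; rewrite inE /= in_itv /= => /andP[_ t0].
    by rewrite ler0_norm // mulN1r.
  have -> : \int[m]_(t in `]0, n.+1%:R]) `|t| = \int[m]_(t in `]0, n.+1%:R]) t.
    apply: eq_Rintegral => t; rewrite inE /= in_itv /= => /andP[t0 _].
    by rewrite gtr0_norm.
  rewrite !(first_moment_itv sa sf PE mE) //.
  have := bd _ _ nn; have := bd _ _ nn'; rewrite !ler_norml; lra.
have c1 := Rintegral_symitv_cvg fi.
have c2 := cvgs_dot (y := y) (Qs_cvg (A x)).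
apply: (cvg_unique _ c1) => //.
rewrite (_ : (fun n => _) = (fun n => dot y (Qs n (A x)))) //.
by apply/funext => n; rewrite (first_moment_itv sa sf PE mE) ?symitv_le // AQ.
Qed.

(** The restriction of W |-> <y, P W x> to a set Po is W |-> <P Po y, P W x>. Both
    Jordan parts are thus of the form to which first_moment applies, and the
    projections of the two sets of a Hahn decomposition add up to the identity. *)
Lemma charge_integral_id (nu : {charge set (measurableTypeR R) -> \bar R}) x y :
  (forall W, measurable W -> nu W = (dot y (P W x))%:E) -> D x ->
  charge_integral nu (fun t : R => t%:C) = (dot y (A x))%:C.
Proof.
move=> nuE Dx; rewrite /charge_integral.
case: (cid _) => Po exN; case: cid => N /= hPN.
have [[mPo _] [mN _] PNT PN0] := hPN.
have mint (m : {measure set (measurableTypeR R) -> \bar R}) z :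
    (forall W, measurable W -> m W = (dot z (P W x))%:E) ->
    mintegral m (fun t : R => t%:C) = (dot z (A x))%:C.
  move=> mE; rewrite /mintegral /= -(first_moment mE Dx); congr (_ +i* _).
  by rewrite Rintegral_cst // mul0r.
rewrite (@mint _ (P Po y)) ?(@mint _ (- P N y)) //.
- rewrite -raddfB /= -dotBl opprK -pvmU // PNT.
  by rewrite pvmT.
- move=> W mW; apply: etrans (jordan_negE _ _) _; rewrite cjordan_negE /crestr0.
  rewrite mem_set // /crestr nuE; last exact: measurableI.
  by rewrite setIC pvmI // dotNl (proj_sym (pvm_isproj P mN)).
- move=> W mW; apply: etrans (jordan_posE _ _) _; rewrite cjordan_posE /crestr0.
  rewrite mem_set // /crestr nuE; last exact: measurableI.
  by rewrite setIC pvmI // (proj_sym (pvm_isproj P mPo)).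
Qed.

Lemma cintegral_id x y : D x ->
  cintegral (pvm_cmeasure P x y) (fun t : R => t%:C) = inner y (A x).
Proof.
move=> Dx; rewrite /cintegral (@charge_integral_id _ x y) //.
rewrite (@charge_integral_id _ x ('i *: y)) //; last first.
  by move=> W mW; rewrite dotil.
by rewrite dotil -complexE.
Qed.

End Integral.

(** * The spectral theorem *)

Section FromUnboundedOperator.
Context {R : realType} {H : hilbertType R}.
Variable A : unbounded_operator H.

Lemma ler_normr_inner (x y : H) (c : R) :
  (forall a : R[i], `|a| = 1 -> dot x (a *: y) <= c) -> `|inner x y| <= (2 * c)%:C.
Proof.
move=> h; rewrite (le_trans (norm_innerW x y)) // lecR mulr_natl mulr2n.
(* the four phases 1, -1, i, -i bound the real and imaginary parts *)
have n1 : `|1 : R[i]| = 1 by rewrite normr1.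
have nm1 : `|- 1 : R[i]| = 1 by rewrite normrN normr1.
have nmi : `|- 'i : R[i]| = 1 by rewrite normrN normr_i.
have := h _ n1; have := h _ nm1; have := h _ normr_i; have := h _ nmi.
rewrite scale1r !scaleNr scale1r !dotNr => h1 h2 h3 h4.
by apply: lerD; rewrite ler_norml; apply/andP; split; lra.
Qed.

(** The values of the adjoint are given by a choice among representing vectors;
    symmetry needs the existence of such a vector, that is Riesz_subspace on the
    domain. *)
Lemma unbounded_operator_selfadj : self_adjoint A -> selfadj (op_dom A) A.
Proof.
move=> [domA eqA].
have A0 : A 0 = 0.
  have := op_linear 1 (op_dom0 A) (op_dom0 A); rewrite !scale1r addr0 => /eqP.
  by rewrite -subr_eq0 opprD addrA subrr add0r oppr_eq0 => /eqP.
have AZ a y : op_dom A y -> A (a *: y) = a *: A y.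
  by move=> Dy; rewrite -[_ *: y]addr0 op_linear ?A0 ?addr0 //; exact: op_dom0.
have DZ a y : op_dom A y -> op_dom A (a *: y).
  by move=> Dy; rewrite -[_ *: _]addr0; apply: op_domP => //; exact: op_dom0.
split.
- exact: op_dom0.
- exact: op_domP.
- exact: op_linear.
- move=> x; have /choice [u hu] n : exists y, op_dom A y /\ nr (y - x) < n.+1%:R^-1.
    have n0 : (0 : R[i]) < (n.+1%:R^-1 : R)%:C by rewrite ltcR invr_gt0.
    have ob : open (ball x (n.+1%:R^-1 : R)%:C) by exact: ball_open.
    have [|y [xy Dy]] := @op_dense _ _ A _ _ ob.
      by exists x; exact: ballxx.
    exists y; split=> //; move: xy; rewrite -ball_normE /= normE ltcR.
    by rewrite nr_distC.
  exists u => [n|]; first by case: (hu n).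
  by apply: cvgs_approx => n; case: (hu n).
- move=> x y Dx Dy; rewrite (eqA _ Dx) /=.
  have [M hM] : op_dom (adjoint A) x by rewrite -domA.
  have [||||z [_ hz]] := @Riesz_subspace _ H (op_dom A) (fun y => dot x (A y)) M.
  + exact: op_dom0.
  + by move=> r; exact: op_domP.
  + by move=> r v w Dv Dw; rewrite op_linear // dotE dotZr.
  + move=> v Dv; apply: (le_trans (ler_norm _)); rewrite -lecR rmorphM /= -normE.
    exact: le_trans (normc_ge_Re _) (hM v Dv).
  case: xgetP => [w _ hw|]; last first.
    move=> /(_ z)[] v Dv; apply: inner_dot_eq => a.
    by rewrite (hz _ (DZ a _ Dv)) AZ.
  by rewrite /dot hw.
move=> x M hM; rewrite domA /=; exists (2 * M) => y Dy.
rewrite normE -rmorphM /= -mulrA; apply: ler_normr_inner => a a1.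
rewrite -AZ //; apply: (le_trans (hM _ (DZ a _ Dy))).
suff -> : nr (a *: y) = nr y by [].
by apply: complexI; rewrite -!normE normrZ a1 mul1r.
Qed.

End FromUnboundedOperator.

Theorem theorem1p1 (R : realType) (H : hilbertType R)
    (A : unbounded_operator H) (Asa : self_adjoint A) :
  exists P : projection_valued_measure (measurableTypeR R) H,
    op_eq A (pvm_integral P (fun t : R => t%:C)).
Proof.
have sa := unbounded_operator_selfadj Asa.
have [E sf] := spectral_family_exists sa.
have [|||||P PE] := @pvm_exists _ _ E.
- exact: (sf_proj sf).
- exact: (sf_mono sa sf).
- exact: (sf_right_cvg sa sf).
- exact: (sf_cvg_pinfty sa sf).
- exact: (sf_cvg_ninfty sa sf).
exists P; split=> [|x Dx].
  have sqrE x : (\int[pvm_measure P x]_(t in setT)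
      (complex.Re (`|(t : R)%:C : R[i]| ^+ 2))%:E =
      \int[pvm_measure P x]_t (t ^+ 2)%:E)%E.
    apply: eq_integral => t _; congr _%:E.
    by rewrite normr_real_complex -rmorphXn /= real_normK ?num_real.
  by apply/funext => x; apply/propext; rewrite -(square_integrable_domain sa sf PE) -sqrE.
rewrite /=; case: xgetP => [z _ hz|h].
  apply: dot_inj => y; rewrite /dot hz.
  by rewrite (cintegral_id sa sf PE).
by case: (h (A x)) => y; rewrite (cintegral_id sa sf PE).
Qed.
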